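(* Let $i\in\{1,\dots,k\}$ and let $(u_{i,j},v_{i,j})_{j\in\mathbb{N}}$ be the sequence generated by the alternating minimization scheme $$u_{i,j}=\operatorname{arg\,min}\{\mathcal{E}_h(u,v_{i,j-1}):u\in\mathcal{X}_h,\ u=g(t_i)\text{ on }\partial\omega\},$$ $$v_{i,j}=\operatorname{arg\,min}\Big\{\mathcal{F}_h(u_{i,j},v)+\frac{\alpha}{2\tau}\|v-v_{i-1}\|_{\mathcal{X}_h}^2:v\in\mathcal{X}_h,\ v\le v_{i-1}\Big\},$$ for $j\ge1$, with $u_{i,0}=u_{i-1}$ and $v_{i,0}=v_{i-1}$. Then, up to a subsequence, $(u_{i,j},v_{i,j})$ converges as $j\to\infty$ to a discrete critical point $(u_i,v_i)\in\mathcal{X}_h\times\mathcal{X}_h$ with bound $v_{i-1}$.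
   Context: Geometry and coefficients. Greek indices range over $\{1,2\}$; repeated ones are summed. $\omega\subset\mathbb{R}^2$ is a (bounded, Lipschitz) polygonal domain; $\phi\in C^2(\bar\omega;\mathbb{R}^3)$ is an injective immersion. $a_\alpha=\partial_\alpha\phi$, $a_3=\frac{a_1\times a_2}{|a_1\times a_2|}$, $a_{\alpha\beta}=a_\alpha\cdot a_\beta$, $(a^{\alpha\beta})=(a_{\alpha\beta})^{-1}$, $a=\det(a_{\alpha\beta})$, $b_{\alpha\beta}=a_3\cdot\partial_\alpha a_\beta$. Constants $\lambda\ge0$, $\mu,\kappa,\varepsilon,\eta_\varepsilon,\alpha>0$ are fixed. $\boldsymbol{c}^{\alpha\beta\sigma\tau}=\frac{2\lambda\mu}{\lambda+2\mu}a^{\alpha\beta}a^{\sigma\tau}+\mu(a^{\alpha\sigma}a^{\beta\tau}+a^{\alpha\tau}a^{\beta\sigma})$, $b=\boldsymbol{c}^{\alpha\beta\sigma\tau}b_{\alpha\beta}b_{\sigma\tau}\sqrt a$, $A=\sqrt a\,(a^{\alpha\beta})$ (symmetric, uniformly positive definite). Finite elements. $\mathcal{T}_h$ is a triangulation of $\omega$; $\mathcal{X}_h=\{u\in H^1(\omega):u|_T\in\mathbb{P}_1(T)\ \forall T\in\mathcal{T}_h\}$ with Lagrangian basis $\{\xi_l\}_{l=1}^{N_h}$; $\Pi_h$ is the Lagrangian (nodal) interpolant onto $\mathcal{X}_h$; $\|v\|_{\mathcal{X}_h}=(\int_\omega|\Pi_h(v^2)|\,dx)^{1/2}$. It is assumed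 that $\int_\omega\nabla\xi_l^\top A\nabla\xi_m\,dx\le0$ for all $l\ne m$. Energies, for $u,v\in\mathcal{X}_h$: $\mathcal{E}_h(u,v)=\frac12\int_\omega b|u|^2dx+\frac\mu2\int_\omega(\Pi_h(v^2)+\eta_\varepsilon)\nabla u^\top A\nabla u\,dx$, $\mathcal{D}_h(v)=\kappa\int_\omega[\frac1{4\varepsilon}\Pi_h((1-v)^2)\sqrt a+\varepsilon\nabla v^\top A\nabla v]\,dx$, $\mathcal{F}_h(u,v)=\mathcal{E}_h(u,v)+\mathcal{D}_h(v)$, with derivatives $\partial_u\mathcal{E}_h(u,v)[\varphi]=\int_\omega bu\varphi\,dx+\mu\int_\omega(\Pi_h(v^2)+\eta_\varepsilon)\nabla u^\top A\nabla\varphi\,dx$, $\partial_v\mathcal{F}_h(u,v)[\psi]=\mu\int_\omega\Pi_h(v\psi)\nabla u^\top A\nabla u\,dx+\kappa\int_\omega[\frac1{2\varepsilon}\Pi_h((v-1)\psi)\sqrt a+2\varepsilon\nabla v^\top A\nabla\psi]\,dx$. Time discretization. $T_f>0$, $k\in\mathbb{N}$, $\tau=T_f/k$, $t_i=i\tau$; $g\in AC([0,T_f];W^{1,p}(\omega))$ with $p>2$ is the Dirichlet datum, such that for every $i$ the class $\{u\in\mathcal{X}_h:u=g(t_i)\text{ on }\partial\omega\}$ is non-empty. Initial data $u_0,v_0\in\mathcal{X}_h$ with $0\le v_0\le1$ are given. The states $(u_i,v_i)$ are defined inductively: at step $i$, from $(u_{i-1},v_{i-1})$ one generates $(u_{i,j},v_{i,j})_j$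 by the scheme, and $(u_i,v_i)$ is a limit of $(u_{i,j},v_{i,j})_j$ along some convergent subsequence. Discrete critical point. For $u,v,\tilde v\in\mathcal{X}_h$ with $0\le\tilde v\le1$, $(u,v)$ is a discrete critical point with bound $\tilde v$ if $\partial_u\mathcal{E}_h(u,v)[\varphi]=0$ and $\partial_v\mathcal{F}_h(u,v)[v-\psi]+\frac\alpha\tau\int_\omega\Pi_h((v-\tilde v)(v-\psi))\,dx\le0$ for all $\varphi,\psi\in\mathcal{X}_h$ with $\varphi=0$ on $\partial\omega$ and $\psi\le\tilde v$. *)

(* Defs.v *)
From HB Require Import structures.
From mathcomp Require Import all_boot all_order all_algebra.
From mathcomp Require Import all_classical all_reals all_analysis.

Set Implicit Arguments.
Unset Strict Implicit.
Unset Printing Implicit Defensive.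

Import Order.TTheory GRing.Theory Num.Theory.
Import numFieldNormedType.Exports.

Local Open Scope classical_set_scope.
Local Open Scope ring_scope.

(* Functions on omega, or on its closure, are total functions R * R -> R; only
   their values on closure omega are ever used. The indices 1, 2 are the two
   elements of 'I_2. *)

Notation leb2 R := (@lebesgue_measure R \x @lebesgue_measure R)%E.

Definition basis_vec (R : realType) (i : 'I_2) : R * R :=
  if i == 0 then (1, 0) else (0, 1).

Definition bdry (R : realType) (om : set (R * R)) : set (R * R) :=
  closure om `\` om°.

Definition argmin (R : realType) (T : Type) (J : T -> R) (C : set T) (w : T) :
    Prop :=
  C w /\ forall w', C w' -> J w <= J w'.

(** * Polygonal Lipschitz domains *)

(* Near every boundary point, in a rotated orthonormal frame centred there, om
   is the set lying below the graph of a Lipschitz function. *)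
Definition lipschitz_boundary (R : realType) (om : set (R * R)) : Prop :=
  forall x, bdry om x ->
  exists (c s r h L : R) (f : R -> R),
  [/\ c ^+ 2 + s ^+ 2 = 1, 0 < r, 0 < h,
      forall t t', `|f t - f t'| <= L * `|t - t'| &
      forall y : R * R,
        let t := c * (y.1 - x.1) + s * (y.2 - x.2) in
        let n := - s * (y.1 - x.1) + c * (y.2 - x.2) in
        `|t| < r -> `|n| < h -> (om y <-> n < f t)].

Definition segment (R : realType) (p q : R * R) : set (R * R) :=
  [set x | exists t : R, 0 <= t <= 1 /\ x = (1 - t) *: p + t *: q].

Record polygonal_domain (R : realType) (om : set (R * R)) : Prop := {
  pd_nonempty : om !=set0;
  pd_open : open om;
  pd_connected : connected om;
  pd_bounded : bounded_set om;
  pd_polygonal : exists s : seq ((R * R) * (R * R)),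
    bdry om = [set x | exists2 e, e \in s & segment e.1 e.2 x];
  pd_lipschitz : lipschitz_boundary om }.

(** * The midsurface *)

(* phi of class C^2 up to the boundary: the derivatives up to order two, taken
   in om, are the restrictions of functions d1 i = d_i phi and
   d2 i j = d_i d_j phi that are continuous on closure om. *)
Record surface (R : realType) (om : set (R * R)) := Surface {
  phi : R * R -> 'rV[R]_3;
  d1 : 'I_2 -> R * R -> 'rV[R]_3;
  d2 : 'I_2 -> 'I_2 -> R * R -> 'rV[R]_3;
  phi_cont : {within closure om, continuous phi};
  d1_cont : forall i, {within closure om, continuous (d1 i)};
  d2_cont : forall i j, {within closure om, continuous (d2 i j)};
  phi_deriv : forall i x, om x -> is_derive x (basis_vec R i) phi (d1 i x);
  d1_deriv : forall i j x, om x ->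
    is_derive x (basis_vec R i) (d1 j) (d2 i j x);
  phi_inj : {in closure om &, injective phi};
  phi_immersion : forall x, closure om x -> row_free (\matrix_i d1 i x) }.

Definition dot3 (R : realType) (u v : 'rV[R]_3) : R := (u *m v^T) 0 0.

(* Index arithmetic is modulo 3. *)
Definition cross3 (R : realType) (u v : 'rV[R]_3) : 'rV[R]_3 :=
  \row_k (u 0 (k + 1) * v 0 (k + 2) - u 0 (k + 2) * v 0 (k + 1)).

(* The Euclidean norm; `|_| on 'rV[R]_3 is the sup norm. *)
Definition enorm3 (R : realType) (u : 'rV[R]_3) : R := Num.sqrt (dot3 u u).

Definition normal (R : realType) (om : set (R * R)) (S : surface om)
    (x : R * R) : 'rV[R]_3 :=
  let n := cross3 (d1 S 0 x) (d1 S 1 x) in (enorm3 n)^-1 *: n.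

Definition metric (R : realType) (om : set (R * R)) (S : surface om)
    (x : R * R) : 'M[R]_2 :=
  \matrix_(i, j) dot3 (d1 S i x) (d1 S j x).

Definition metric_inv (R : realType) (om : set (R * R)) (S : surface om)
    (x : R * R) : 'M[R]_2 := invmx (metric S x).

Definition sqrt_a (R : realType) (om : set (R * R)) (S : surface om)
    (x : R * R) : R := Num.sqrt (\det (metric S x)).

Definition curvature (R : realType) (om : set (R * R)) (S : surface om)
    (x : R * R) : 'M[R]_2 :=
  \matrix_(i, j) dot3 (normal S x) (d2 S i j x).

Definition coefA (R : realType) (om : set (R * R)) (S : surface om)
    (x : R * R) : 'M[R]_2 := sqrt_a S x *: metric_inv S x.

Record parameters (R : realType) := MkParameters {
  lambda : R;
  mu : R;
  kappa : R;
  eps : R;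
  eta : R;
  alpha : R;
  lambda_ge0 : 0 <= lambda;
  mu_gt0 : 0 < mu;
  kappa_gt0 : 0 < kappa;
  eps_gt0 : 0 < eps;
  eta_gt0 : 0 < eta;
  alpha_gt0 : 0 < alpha }.

Definition elasticity (R : realType) (P : parameters R) (om : set (R * R))
    (S : surface om) (x : R * R) (i j s t : 'I_2) : R :=
  let a := metric_inv S x in
  2 * lambda P * mu P / (lambda P + 2 * mu P) * a i j * a s t
  + mu P * (a i s * a j t + a i t * a j s).

Definition coefb (R : realType) (P : parameters R) (om : set (R * R))
    (S : surface om) (x : R * R) : R :=
  (\sum_(i < 2) \sum_(j < 2) \sum_(s < 2) \sum_(t < 2)
     elasticity P S x i j s t * curvature S x i j * curvature S x s t)
  * sqrt_a S x.

(** * Sobolev spaces *)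

Fixpoint Ck (R : realType) (n : nat) (f : R * R -> R) : Prop :=
  if n is n'.+1 then
    continuous f /\
    forall i, (forall x, derivable f x (basis_vec R i)) /\
              Ck n' (fun x => 'D_(basis_vec R i) f x)
  else continuous f.

Definition test_function (R : realType) (om : set (R * R)) (f : R * R -> R) :
    Prop :=
  (forall n, Ck n f) /\
  exists K : set (R * R),
    [/\ compact K, K `<=` om & forall x, ~ K x -> f x = 0].

Definition weak_partial (R : realType) (om : set (R * R)) (i : 'I_2)
    (f df : R * R -> R) : Prop :=
  forall psi, test_function om psi ->
  \int[leb2 R]_(x in om) (f x * 'D_(basis_vec R i) psi x)
  = - \int[leb2 R]_(x in om) (df x * psi x).

Definition W1p_norm (R : realType) (om : set (R * R)) (p : R)
    (f : R * R -> R) (df : 'I_2 -> R * R -> R) : \bar R :=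
  (Lnorm (leb2 R) p%:E (EFin \o (f \_ om))
   + \sum_(i < 2) Lnorm (leb2 R) p%:E (EFin \o (df i \_ om)))%E.

(* f belongs to W^{1,p}(om) and df is its weak gradient. *)
Definition W1p (R : realType) (om : set (R * R)) (p : R)
    (f : R * R -> R) (df : 'I_2 -> R * R -> R) : Prop :=
  [/\ measurable_fun (om : set (measurableTypeR R * measurableTypeR R)) f,
      forall i, measurable_fun
        (om : set (measurableTypeR R * measurableTypeR R)) (df i),
      (W1p_norm om p f df < +oo)%E &
      forall i, weak_partial om i f (df i)].

Definition H1 (R : realType) (om : set (R * R)) (f : R * R -> R) : Prop :=
  exists df, W1p om 2 f df.

Definition AC_W1p (R : realType) (om : set (R * R)) (p Tf : R)
    (g : R -> R * R -> R) : Prop :=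
  exists dg : R -> 'I_2 -> R * R -> R,
  (forall t, 0 <= t <= Tf -> W1p om p (g t) (dg t)) /\
  forall e : R, 0 < e -> exists2 d : R, 0 < d &
  forall (n : nat) (a b : 'I_n -> R),
    (forall j, [/\ 0 <= a j, a j <= b j & b j <= Tf]) ->
    (forall j j', j != j' -> b j <= a j' \/ b j' <= a j) ->
    \sum_(j < n) (b j - a j) < d ->
    (\sum_(j < n) W1p_norm om p (g (b j) \- g (a j))%R
                    (fun i => dg (b j) i \- dg (a j) i)%R < e%:E)%E.

(* u = w on the boundary, for w in W^{1,p}(om) with p > 2: by Morrey's embedding
   the trace of w is the restriction of its continuous representative. *)
Definition eq_on_bdry (R : realType) (om : set (R * R)) (u w : R * R -> R) :
    Prop :=
  exists wc : R * R -> R,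
  [/\ {within closure om, continuous wc},
      {ae leb2 R, forall x, om x -> wc x = w x} &
      forall x, bdry om x -> u x = wc x].

(** * Finite elements *)

Definition hull (R : realType) (n : nat) (x : 'I_n -> R * R)
    (T : {set 'I_n}) : set (R * R) :=
  [set y | exists c : 'I_n -> R,
    [/\ forall l, 0 <= c l, forall l, l \notin T -> c l = 0,
        \sum_(l < n) c l = 1 & y = \sum_(l < n) c l *: x l]].

(* Elements are given by their sets of three vertices; tri_conform is the usual
   conformity condition (two elements meet in a common face or not at all). *)
Record triangulation (R : realType) (om : set (R * R)) := Triangulation {
  nvert : nat;
  vert : 'I_nvert -> R * R;
  elements : {set {set 'I_nvert}};
  tri_card : forall T, T \in elements -> #|T| = 3%N;
  tri_nondegenerate : forall T, T \in elements ->
    forall c : 'I_nvert -> R, (forall l, l \notin T -> c l = 0) ->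
      \sum_(l < nvert) c l = 0 -> \sum_(l < nvert) c l *: vert l = 0 ->
      forall l, c l = 0;
  tri_conform : forall T T', T \in elements -> T' \in elements ->
    hull vert T `&` hull vert T' = hull vert (T :&: T');
  tri_cover : closure om = [set x | exists2 T, T \in elements & hull vert T x];
  tri_vert : forall l, exists2 T, T \in elements & l \in T;
  vert_inj : injective vert }.

(* Requiring u to be affine on the closed elements selects the continuous
   representative of the H^1 class. *)
Definition Xh (R : realType) (om : set (R * R)) (M : triangulation om)
    (u : R * R -> R) : Prop :=
  H1 om u /\
  forall T, T \in elements M ->
  exists c0 c1 c2 : R,
    forall x, hull (vert (t := M)) T x -> u x = c0 + c1 * x.1 + c2 * x.2.

Definition lagrange_basis (R : realType) (om : set (R * R))
    (M : triangulation om) (xi : 'I_(nvert M) -> R * R -> R) : Prop :=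
  forall l, Xh M (xi l) /\ forall m, xi l (vert m) = (l == m)%:R.

Definition interp (R : realType) (om : set (R * R)) (M : triangulation om)
    (xi : 'I_(nvert M) -> R * R -> R) (f : R * R -> R) (x : R * R) : R :=
  \sum_(l < nvert M) f (vert l) * xi l x.

Definition Xh_norm (R : realType) (om : set (R * R)) (M : triangulation om)
    (xi : 'I_(nvert M) -> R * R -> R) (v : R * R -> R) : R :=
  Num.sqrt (\int[leb2 R]_(x in om) `|interp xi (fun y => v y ^+ 2) x|).

(* For u in Xh this is the elementwise constant gradient, defined off the null
   set of element edges, hence a.e. equal to the weak gradient of u. *)
Definition grad (R : realType) (u : R * R -> R) (x : R * R) : 'cV[R]_2 :=
  \col_i 'D_(basis_vec R i) u x.

Definition gradA (R : realType) (om : set (R * R)) (S : surface om)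
    (u w : R * R -> R) (x : R * R) : R :=
  ((grad u x)^T *m coefA S x *m grad w x) 0 0.

(** * Energies *)

Definition Eh (R : realType) (P : parameters R) (om : set (R * R))
    (S : surface om) (M : triangulation om)
    (xi : 'I_(nvert M) -> R * R -> R) (u v : R * R -> R) : R :=
  2^-1 * \int[leb2 R]_(x in om) (coefb P S x * `|u x| ^+ 2)
  + mu P / 2 * \int[leb2 R]_(x in om)
      ((interp xi (fun y => v y ^+ 2) x + eta P) * gradA S u u x).

Definition Dh (R : realType) (P : parameters R) (om : set (R * R))
    (S : surface om) (M : triangulation om)
    (xi : 'I_(nvert M) -> R * R -> R) (v : R * R -> R) : R :=
  kappa P * \int[leb2 R]_(x in om)
    ((4 * eps P)^-1 * interp xi (fun y => (1 - v y) ^+ 2) x * sqrt_a S x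
     + eps P * gradA S v v x).

Definition Fh (R : realType) (P : parameters R) (om : set (R * R))
    (S : surface om) (M : triangulation om)
    (xi : 'I_(nvert M) -> R * R -> R) (u v : R * R -> R) : R :=
  Eh P S xi u v + Dh P S xi v.

Definition dEh_u (R : realType) (P : parameters R) (om : set (R * R))
    (S : surface om) (M : triangulation om)
    (xi : 'I_(nvert M) -> R * R -> R) (u v w : R * R -> R) : R :=
  \int[leb2 R]_(x in om) (coefb P S x * u x * w x)
  + mu P * \int[leb2 R]_(x in om)
      ((interp xi (fun y => v y ^+ 2) x + eta P) * gradA S u w x).

Definition dFh_v (R : realType) (P : parameters R) (om : set (R * R))
    (S : surface om) (M : triangulation om)
    (xi : 'I_(nvert M) -> R * R -> R) (u v psi : R * R -> R) : R :=
  mu P * \int[leb2 R]_(x in om)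
    (interp xi (fun y => v y * psi y) x * gradA S u u x)
  + kappa P * \int[leb2 R]_(x in om)
      ((2 * eps P)^-1 * interp xi (fun y => (v y - 1) * psi y) x * sqrt_a S x
       + 2 * eps P * gradA S v psi x).

(** * Critical points and the alternating minimization scheme *)

Definition critical_point (R : realType) (P : parameters R) (om : set (R * R))
    (S : surface om) (M : triangulation om)
    (xi : 'I_(nvert M) -> R * R -> R) (tau : R) (vt u v : R * R -> R) : Prop :=
  [/\ [/\ Xh M u, Xh M v & Xh M vt],
      forall x, closure om x -> 0 <= vt x <= 1,
      forall w, Xh M w -> (forall x, bdry om x -> w x = 0) ->
        dEh_u P S xi u v w = 0 &
      forall psi, Xh M psi -> (forall x, closure om x -> psi x <= vt x) ->
        dFh_v P S xi u v (v \- psi)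
        + alpha P / tau * \int[leb2 R]_(x in om)
            interp xi (fun y => (v y - vt y) * (v y - psi y)) x <= 0].

(* U, V are the iterates of one time step with boundary datum gt, started from
   the state (u0, v0) of the previous time step. *)
Definition alternating_minimization (R : realType) (P : parameters R)
    (om : set (R * R)) (S : surface om) (M : triangulation om)
    (xi : 'I_(nvert M) -> R * R -> R) (tau : R) (gt u0 v0 : R * R -> R)
    (U V : nat -> R * R -> R) : Prop :=
  [/\ U 0%N = u0, V 0%N = v0,
      forall j, argmin (fun u => Eh P S xi u (V j))
                  [set u | Xh M u /\ eq_on_bdry om u gt] (U j.+1) &
      forall j, argmin (fun v => Fh P S xi (U j.+1) v
                          + alpha P / (2 * tau) * Xh_norm xi (v \- v0) ^+ 2)
                  [set v | Xh M v /\ forall x, closure om x -> v x <= v0 x]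
                  (V j.+1)].

(* Xh is finite-dimensional, so its topology is that of the norm Xh_norm. *)
Definition cvg_Xh (R : realType) (om : set (R * R)) (M : triangulation om)
    (xi : 'I_(nvert M) -> R * R -> R) (U : nat -> R * R -> R)
    (u : R * R -> R) : Prop :=
  (fun j => Xh_norm xi (U j \- u)) @ \oo --> (0 : R).

Definition subseq_limit (R : realType) (om : set (R * R))
    (M : triangulation om) (xi : 'I_(nvert M) -> R * R -> R)
    (U V : nat -> R * R -> R) (u v : R * R -> R) : Prop :=
  [/\ Xh M u, Xh M v &
      exists s : nat -> nat,
        [/\ {homo s : m n / (m < n)%N}, cvg_Xh xi (U \o s) u &
            cvg_Xh xi (V \o s) v]].

(* Main.v *)
(* In nodal coordinates all functionals are polynomials: E_h is quadratic in u,
   F_h + alpha/(2 tau) |v - v_(i-1)|^2 is strongly convex in v, and the derivative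
   conditions of a critical point are the stationarity conditions of the two
   partial minimizations. Replacing the nodal values of v by their positive parts
   lowers the energy, because the stiffness matrix has nonpositive off-diagonal
   entries; hence the v_j take values in [0, 1]. Then the energies E_h(u_j, v_(j-1))
   are bounded, and since b >= 0 they control the Dirichlet form of u_j. As the u_j
   agree on the boundary, and a function of Xh with zero boundary values and zero
   gradient vanishes, the u_j are bounded and a subsequence converges. Strong
   convexity gives J_j - J_(j+1) >= c |v_(j+1) - v_j|^2 for the decreasing energies
   J_j, so v_j and v_(j-1) have the same limit along the subsequence and both
   stationarity conditions pass to the limit. *)

Require Import Defs.
From HB Require Import structures.
From mathcomp Require Import all_boot all_order all_algebra.
From mathcomp Require Import all_classical all_reals all_analysis measurable_realfun.
From mathcomp Require Import ring lra.
Import Order.TTheory GRing.Theory Num.Theory.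
Import numFieldNormedType.Exports.
Local Open Scope classical_set_scope.
Local Open Scope ring_scope.

Set Implicit Arguments.
Unset Strict Implicit.
Unset Printing Implicit Defensive.

(** * Lebesgue measure on the plane *)

(** All zero-order terms in v pass through the nodal interpolant, so they are diagonal in the nodal
    values; only the stiffness term couples vertices. This is why truncation at 0 can be compared
    term by term, and why the constant c of the strong convexity estimate can be read off the
    penalty alone: alpha/(2 tau) times the integral of a hat function. Positivity of [eta P] bounds
    the weight of the Dirichlet form in E_h from below whatever v is, so the bound on u_j is uniform
    in j. Coercivity on functions with zero boundary values follows from definiteness by compactness
    in the finite-dimensional space of nodal vectors. On the analytic side, 'D has unspecified
    values on the element edges; every integral is therefore evaluated off a null set of lines,
    where gradients are constant on each element. The bound 0 <= v_(i-1) <= 1 from which a time step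
    starts is itself obtained by induction over the earlier steps, for arbitrary subsequential
    limits. *)

Lemma measurable_open2 (R : realType) (A : set (R * R)) : open A ->
  measurable (A : set (measurableTypeR R * measurableTypeR R)).
Proof.
move=> oA.
(* Balls of [R * R] are products of balls, so each one is a measurable rectangle; rational centres
   and radii 1/(n+1) leave countably many of them inside [A]. *)
pose B (a b : rat) (n : nat) : set (R * R) :=
  if asbool (ball ((ratr a, ratr b) : R * R) n.+1%:R^-1 `<=` A)
  then ball (ratr a : R) n.+1%:R^-1 `*` ball (ratr b : R) n.+1%:R^-1 else set0.
have -> : A = \bigcup_a \bigcup_b \bigcup_n B a b n.
  apply/seteqP; split => [[x y] Axy|[x y] [a _ [b _ [n _]]]]; last first.
    by rewrite /B; case: asboolP => // + [/= ? ?]; apply.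
  have [e /= e0 eA] : nbhs_ball ((x, y) : R * R) A by rewrite nbhs_ballE; exact: open_nbhs_nbhs.
  have [n n0] : exists n : nat, n.+1%:R^-1 < e / 2.
    have [n _ /(_ n (leqnn n))] := @cvgr0_norm_lt _ R^o _ _ _ _ (@cvg_harmonic R) (e/2)
      (divr_gt0 e0 (ltr0n _ 2)).
    by exists n; apply: le_lt_trans (ler_norm _) _.
  have rat_near (z : R) : exists q : rat, ball (ratr q : R) n.+1%:R^-1 z.
    have r0 : 0 < n.+1%:R^-1 :> R by rewrite invr_gt0.
    have [|w [zw [q _ qw]]] := @dense_rat R (ball z n.+1%:R^-1) _ (ball_open _ _).
      by exists z; exact: ballxx.
    by exists q; rewrite qw; exact: ball_sym.
  have near_ball (q s t : R) : ball q n.+1%:R^-1 s -> ball q n.+1%:R^-1 t -> ball s e t.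
    move=> /ball_sym qs qt; apply: le_ball (ball_triangle qs qt).
    by rewrite [leRHS]splitr lerD// ltW.
  have [[a xa] [b yb]] := (rat_near x, rat_near y).
  exists a => //; exists b => //; exists n => //.
  rewrite /B asboolT// => -[z t] [/= za tb]; apply: eA.
  by split; [exact: near_ball xa za|exact: near_ball yb tb].
apply: bigcupT_measurable_rat => a; apply: bigcupT_measurable_rat => b.
apply: bigcupT_measurable => n; rewrite /B; case: ifP => // _.
by apply: measurableX; exact: measurable_ball.
Qed.

Lemma leb2_ballX (R : realType) (x y e : R) : 0 <= e ->
  leb2 R (ball x e `*` ball y e) = ((e *+ 2) * (e *+ 2))%:E.
Proof.
move=> e0; have mb z : measurable (ball (z : R) e : set (measurableTypeR R)).
  exact: measurable_ball.
by rewrite product_measure1E// EFinM; congr (_ * _)%E; exact: lebesgue_measure_ball.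
Qed.

Lemma leb2_bounded (R : realType) (A : set (R * R)) : bounded_set A ->
  measurable (A : set (measurableTypeR R * measurableTypeR R)) ->
  (leb2 R A < +oo)%E.
Proof.
move=> [M0 [_ hM]] mA; pose M := `|M0| + 2.
have M0M : M0 < `|M0| + 1 by rewrite (le_lt_trans (ler_norm _))// ltrDl.
have mb z e : measurable (ball (z : R) e : set (measurableTypeR R)) by exact: measurable_ball.
have M_ge0 : 0 <= M by rewrite addr_ge0.
apply: (@le_lt_trans _ _ (leb2 R (ball (0 : R) M `*` ball (0 : R) M))).
  apply: le_measure; rewrite ?inE//; first exact: measurableX.
  move=> x /(hM _ M0M) /=; rewrite ge_max => /andP[x1 x2].
  by split; rewrite /= -ball_normE /= sub0r normrN (le_lt_trans _ (_ : `|M0| + 1 < M))//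
    ltrD2l ltr1n.
by rewrite leb2_ballX// ltry.
Qed.

Lemma leb2_open_gt0 (R : realType) (A : set (R * R)) : open A -> A !=set0 ->
  (0 < leb2 R A)%E.
Proof.
move=> oA [[x y] Axy].
have [e /= e0 eA] : nbhs_ball ((x, y) : R * R) A by rewrite nbhs_ballE; exact: open_nbhs_nbhs.
have mb z : measurable (ball (z : R) e : set (measurableTypeR R)) by exact: measurable_ball.
apply: (@lt_le_trans _ _ (leb2 R (ball x e `*` ball y e))).
  by rewrite leb2_ballX ?ltW// lte_fin mulr_gt0// pmulrn_lgt0.
apply: le_measure; rewrite ?inE//.
- exact: measurableX.
- exact: measurable_open2.
Qed.

(** For c = 0 the line is the product of a point and R; otherwise every section over the first
    coordinate is a point. *)
Lemma leb2_line (R : realType) (a b c : R) : (b != 0) || (c != 0) ->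
  leb2 R [set x | a + b * x.1 + c * x.2 = 0] = 0%E.
Proof.
move=> bc0.
have [c0|c0] := eqVneq c 0.
  rewrite c0 eqxx orbF in bc0.
  have -> : [set x : R * R | a + b * x.1 + c * x.2 = 0] = [set (- a / b)] `*` setT.
    apply/seteqP; split => -[x y] /=; rewrite c0 mul0r addr0 => h.
      split => //; apply: (mulfI bc0); move/eqP: h; rewrite addrC addr_eq0 => /eqP ->.
      by rewrite mulrCA mulfV ?mulr1.
    by case: h => -> _; rewrite mulrCA mulfV// mulr1 subrr.
  have m1 : measurable ([set - a / b] : set (measurableTypeR R)) by exact: measurable_set1.
  by rewrite product_measure1E// [X in (X * _)%E](_ : _ = 0%E) ?mul0e//;
    exact: lebesgue_measure_set1.
rewrite /product_measure1 /=.
apply: integral0_eq => x _ /=.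
rewrite (_ : xsection _ _ = [set (- (a + b * x) / c)]); first exact: lebesgue_measure_set1.
apply/seteqP; split => y; rewrite xsectionE /preimage /=.
  move=> h; apply: (mulfI c0); move/eqP: h; rewrite addrC addr_eq0 => /eqP ->.
  by rewrite mulrCA mulfV ?mulr1.
by move=> ->; rewrite mulrCA mulfV// mulr1 subrr.
Qed.

Section integral_null.
Import HBNNSimple.
Context d (T : measurableType d) (R : realType) (mu : {measure set T -> \bar R}).
Local Open Scope ereal_scope.

(* The integrands of the energies involve 'D_v, which has junk values on the edges
   of the triangulation; discarding the edges must not presuppose that these
   values form a measurable function. *)
Lemma integral_setD_null (D N : set T) (f : T -> \bar R) :
  measurable N -> mu N = 0 ->
  \int[mu]_(x in D) f x = \int[mu]_(x in D `\` N) f x.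
Proof.
move=> mN N0.
suff ge0 (g : T -> \bar R) : (forall x, 0 <= g x) ->
    \int[mu]_(x in D) g x = \int[mu]_(x in D `\` N) g x.
  by rewrite integralE [RHS]integralE !ge0.
move=> g0; rewrite !ge0_integralE//.
have sub : forall x, (g \_ (D `\` N)) x <= (g \_ D) x.
  move=> x; rewrite !patchE.
  case: ifPn => [|_]; last by case: ifP => // _; exact: g0.
  by rewrite inE => -[xD _]; rewrite mem_set.
apply/eqP; rewrite eq_le; apply/andP; split; last first.
  apply: le_ereal_sup => _ [h hg <-]; exists h => // x.
  exact: le_trans (hg x) (sub x).
(* The integral is a supremum over simple functions. A competitor [h] on [D] becomes one on the
   smaller set once it is put to zero on [N], and this keeps its integral. *)
apply: ge_ereal_sup => _ [h hg <-].
apply: ereal_sup_ubound.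
pose hN := proj_nnsfun h (measurableC mN).
have hNE x : hN x = (h x * (x \in ~` N)%:R)%R by rewrite -indicE.
exists hN.
  move=> x; rewrite hNE patchE; case: ifPn.
    rewrite inE => -[xD xN]; rewrite mem_set// mulr1.
    by have := hg x; rewrite patchE mem_set.
  rewrite notin_setE => xDN; have := hg x; rewrite patchE.
  case: (asboolP (N x)) => xN; first by rewrite [x \in ~` N]memNset ?mulr0// => /(_ xN).
  rewrite [x \in ~` N]mem_set// mulr1; case: ifPn => //; rewrite inE => xD.
  by exfalso; apply: xDN.
rewrite -!integralT_nnsfun.
rewrite [RHS](@ge0_negligible_integral _ _ _ mu setT N)//.
- rewrite [LHS](@ge0_negligible_integral _ _ _ mu setT N)//.
  + apply: eq_integral => x; rewrite inE => -[_ xN].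
    by rewrite hNE mem_set// mulr1.
  + exact/measurable_EFinP.
  + by move=> x _; rewrite lee_fin.
- exact/measurable_EFinP.
- by move=> x _; rewrite lee_fin.
Qed.

End integral_null.

(** * Alternating minimization in nodal coordinates *)

Section alternating_quadratic.
Context {R : realType} {I : finType}.
Implicit Types (A : I -> I -> R) (c d e h z : I -> R) (s t : R).

Definition bil A c e : R := \sum_l \sum_m A l m * c l * e m.

Definition comb c t e : I -> R := fun l => c l + t * e l.

Lemma bil_combl A c t e h : bil A (comb c t e) h = bil A c h + t * bil A e h.
Proof.
rewrite /bil mulr_sumr -big_split; apply: eq_bigr => l _ /=.
rewrite mulr_sumr -big_split; apply: eq_bigr => m _ /=; rewrite /comb; ring.
Qed.

Lemma bil_combr A c t e h : bil A h (comb c t e) = bil A h c + t * bil A h e.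
Proof.
rewrite /bil mulr_sumr -big_split; apply: eq_bigr => l _ /=.
rewrite mulr_sumr -big_split; apply: eq_bigr => m _ /=; rewrite /comb; ring.
Qed.

Lemma bilC A c e : (forall l m, A l m = A m l) -> bil A c e = bil A e c.
Proof.
move=> sA; rewrite /bil exchange_big; apply: eq_bigr => l _; apply: eq_bigr => m _.
by rewrite sA; ring.
Qed.

Lemma bil_comb2 A c t e : (forall l m, A l m = A m l) ->
  bil A (comb c t e) (comb c t e) =
  bil A c c + t * (2 * bil A c e) + t ^+ 2 * bil A e e.
Proof. by move=> sA; rewrite bil_combl !bil_combr (bilC e c sA); ring. Qed.

Lemma sum_quadratic (J : finType) (f x y w : J -> R) t :
  (forall k, f k = x k + t * y k + t ^+ 2 * w k) ->
  \sum_k f k = \sum_k x k + t * (\sum_k y k) + t ^+ 2 * (\sum_k w k).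
Proof.
by move=> fE; rewrite !mulr_sumr -!big_split; apply: eq_bigr => k _ /=.
Qed.

(** First-order condition at a minimum: [l] and [q] are the coefficients of an energy increment that
    is exactly quadratic in [t]. *)
Lemma slope_eq0 (l q : R) : (forall t, 0 <= t * l + t ^+ 2 * q) -> l = 0.
Proof.
move=> h; apply/eqP; apply: contraT => l0.
pose D := `|q| + 1; have D0 : 0 < D by rewrite ltr_pwDr.
have := h (- l / D); have : q <= D by rewrite (le_trans (ler_norm _))// lerDl.
have : 0 < l ^+ 2 by rewrite exprn_even_gt0.
move=> l2 qD; have -> : - l / D * l + (- l / D) ^+ 2 * q = (l / D) ^+ 2 * (q - D).
  by field; rewrite gt_eqF.
have qD' : q < D by rewrite (le_lt_trans (ler_norm _))// ltrDl.
rewrite leNgt => /negP; case.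
by rewrite pmulr_rlt0 ?subr_lt0// exprn_even_gt0//= mulf_neq0// invr_neq0// gt_eqF.
Qed.

Lemma slope_ge0 (l q : R) :
  (forall t, 0 <= t <= 1 -> 0 <= t * l + t ^+ 2 * q) -> 0 <= l.
Proof.
move=> h; rewrite leNgt; apply/negP => l0.
(* The summand |l| keeps t = -l / D at most 1, and |q| + 1 makes D exceed q, so the increment is
   negative at t. *)
pose D := `|q| + `|l| + 1; have D0 : 0 < D by rewrite ltr_pwDr// addr_ge0.
pose t := - l / D.
have t0 : 0 < t by rewrite divr_gt0// oppr_gt0.
have t1 : t <= 1.
  rewrite ler_pdivrMr// mul1r /D (@le_trans _ _ `|l|)//; first by rewrite -normrN ler_norm.
  by rewrite -addrA addrCA lerDl addr_ge0.
have := h t; rewrite t1 (ltW t0) => /(_ isT).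
have -> : t * l + t ^+ 2 * q = t * (t * q + l) by ring.
rewrite pmulr_rge0// leNgt => /negP; apply.
have -> : t * q + l = l / D * (D - q) by rewrite /t; field; rewrite gt_eqF.
rewrite nmulr_rlt0; last by rewrite pmulr_llt0 ?invr_gt0.
rewrite subr_gt0 (le_lt_trans (ler_norm _))// /D -addrA ltrDl.
by rewrite ltr_pwDr.
Qed.

End alternating_quadratic.

(** * Extraction of a common subsequence for finitely many bounded sequences *)

Section bolzano_weierstrass_finite.
Context {R : realType} {I : finType}.

Lemma increasing_seq_ge (s : nat -> nat) :
  {homo s : m n / (m < n)%N} -> forall n, (n <= s n)%N.
Proof. by move=> hs; elim=> // n /leq_ltn_trans; apply; exact: hs. Qed.

Lemma cvg_subseq (u : R ^nat) (a : R) (s : nat -> nat) :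
  {homo s : m n / (m < n)%N} -> u @ \oo --> a -> (u \o s) @ \oo --> a.
Proof.
move=> hs ua; apply: (@cvg_comp _ _ _ s u \oo \oo _ _ ua) => A [n _ nA].
exists n => // m /= nm; apply: nA => /=.
exact: leq_trans nm (increasing_seq_ge hs m).
Qed.

Lemma cvg_sumr (J : finType) (f : J -> R ^nat) (a : J -> R) :
  (forall k, f k @ \oo --> a k) ->
  (fun j => \sum_k f k j) @ \oo --> \sum_k a k.
Proof. by move=> fa; apply: cvg_big => //; exact: add_continuous. Qed.

Lemma sqr_cvg0 (u : R ^nat) :
  (fun j => u j ^+ 2) @ \oo --> (0 : R) -> u @ \oo --> (0 : R).
Proof.
move=> u2; apply/cvgr0Pnorm_lt => e e0.
move/cvgr0Pnorm_lt : u2 => /(_ _ (exprn_gt0 2 e0)); apply: filterS => j.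
by rewrite /= normrX ltr_pXn2r ?nnegrE ?(ltW e0).
Qed.

(** Coordinates are treated one after another along the enumeration of [I]; each extraction
    preserves the convergence of those already treated. *)
Lemma bolzano_weierstrass_fin (u : nat -> I -> R) (M : R) :
  (forall j l, `|u j l| <= M) ->
  exists2 s : nat -> nat, {homo s : m n / (m < n)%N} &
  exists a : I -> R, forall l, (fun j => u (s j) l) @ \oo --> a l.
Proof.
move=> uM.
suff [s hs sr] : exists2 s : nat -> nat, {homo s : m n / (m < n)%N} &
    forall l, l \in enum I -> cvgn (fun j => u (s j) l).
  exists s => //; exists (fun l => limn (fun j => u (s j) l)) => l.
  by apply: sr; rewrite mem_enum.
elim: (enum I) => [|x r [s hs sr]]; first by exists id.
have [|f incf cf] := @bolzano_weierstrass R (fun j => u (s j) x).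
  exists M; split; first exact: num_real.
  by move=> N MN j _ /=; rewrite (le_trans (uM _ _))// ltW.
have hf : {homo f : m n / (m < n)%N} by move=> m n mn; rewrite (leqW_mono incf).
exists (s \o f) => [m n mn|l]; first exact/hs/hf.
rewrite inE => /predU1P[->//|lr].
by have := sr l lr => /(cvg_subseq hf) /cvgP.
Qed.

End bolzano_weierstrass_finite.

(** * Alternating minimization for abstract nodal energies *)

Section alternating_minimization_coefficients.
Context {R : realType} {I : finType}.
Variables (B KK : I -> I -> R) (K : I -> I -> I -> R) (s w : I -> R).
Variables (mu kappa eps eta gam : R).
Implicit Types (c d e h z : I -> R) (t : R).

(* In nodal coordinates c of u and d of v, Ec, Dc and Jc are the functionals E_h,
   D_h and F_h + gam / 2 |v - z|^2, and dEc, dJc their derivatives in u and v. *)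
Definition Ec c d : R := 2^-1 * bil B c c
  + mu / 2 * \sum_k (d k ^+ 2 + eta) * bil (K k) c c.

Definition Dc d : R := kappa *
  ((4 * eps)^-1 * (\sum_k (1 - d k) ^+ 2 * s k) + eps * bil KK d d).

Definition Jc z c d : R := Ec c d + Dc d
  + gam / 2 * \sum_k (d k - z k) ^+ 2 * w k.

Definition dEc c d e : R := bil B c e
  + mu * \sum_k (d k ^+ 2 + eta) * bil (K k) c e.

Definition dJc z c d h : R := mu * (\sum_k d k * h k * bil (K k) c c)
  + kappa * ((2 * eps)^-1 * (\sum_k (d k - 1) * h k * s k)
             + 2 * eps * bil KK d h)
  + gam * \sum_k (d k - z k) * h k * w k.

Hypotheses (symB : forall l m, B l m = B m l)
  (symK : forall k l m, K k l m = K k m l)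
  (symKK : forall l m, KK l m = KK m l).
Hypotheses (mu0 : 0 < mu) (kappa0 : 0 < kappa) (eps0 : 0 < eps) (eta0 : 0 < eta)
  (gam0 : 0 < gam).
(** [K k] is the stiffness matrix weighted by the k-th hat function, and [KK_sum] expresses that the
    hat functions form a partition of unity. *)
Hypotheses (B_ge0 : forall c, 0 <= bil B c c)
  (K_ge0 : forall k c, 0 <= bil (K k) c c)
  (KK_sum : forall c e, bil KK c e = \sum_k bil (K k) c e)
  (s_ge0 : forall k, 0 <= s k) (w_gt0 : forall k, 0 < w k).

Let mu_ge0 : 0 <= mu := ltW mu0.
Let kappa_ge0 : 0 <= kappa := ltW kappa0.
Let eps_ge0 : 0 <= eps := ltW eps0.
Let eta_ge0 : 0 <= eta := ltW eta0.
Let gam_ge0 : 0 <= gam := ltW gam0.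
Let w_ge0 k : 0 <= w k := ltW (w_gt0 k).

Lemma KK_ge0 c : 0 <= bil KK c c.
Proof. by rewrite KK_sum sumr_ge0. Qed.

Lemma Ec_comb c d e t : Ec (comb c t e) d = Ec c d + t * dEc c d e
  + t ^+ 2 * Ec e d.
Proof.
rewrite /Ec /dEc bil_comb2//.
rewrite (sum_quadratic (x := fun k => (d k ^+ 2 + eta) * bil (K k) c c)
  (y := fun k => 2 * ((d k ^+ 2 + eta) * bil (K k) c e))
  (w := fun k => (d k ^+ 2 + eta) * bil (K k) e e) (t := t)); last first.
  by move=> k; rewrite bil_comb2//; ring.
by rewrite -mulr_sumr; field.
Qed.

(** Half the second derivative of [Jc] in its last argument; it depends neither on [z] nor on the
    base point. *)
Definition Qc c h : R := mu / 2 * (\sum_k h k ^+ 2 * bil (K k) c c)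
  + kappa * ((4 * eps)^-1 * (\sum_k h k ^+ 2 * s k) + eps * bil KK h h)
  + gam / 2 * \sum_k h k ^+ 2 * w k.

Lemma Jc_comb z c d h t : Jc z c (comb d t h) = Jc z c d + t * dJc z c d h
  + t ^+ 2 * Qc c h.
Proof.
rewrite /Jc /Ec /Dc /dJc /Qc bil_comb2//.
rewrite (sum_quadratic (x := fun k => (d k ^+ 2 + eta) * bil (K k) c c)
  (y := fun k => 2 * (d k * h k * bil (K k) c c))
  (w := fun k => h k ^+ 2 * bil (K k) c c) (t := t)); last first.
  by move=> k; rewrite /comb; ring.
rewrite (sum_quadratic (f := fun k => (1 - comb d t h k) ^+ 2 * s k) (x :=
  fun k => (1 - d k) ^+ 2 * s k)
  (y := fun k => 2 * ((d k - 1) * h k * s k))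
  (w := fun k => h k ^+ 2 * s k) (t := t)); last first.
  by move=> k; rewrite /comb; ring.
rewrite (sum_quadratic (f := fun k => (comb d t h k - z k) ^+ 2 * w k) (x :=
  fun k => (d k - z k) ^+ 2 * w k)
  (y := fun k => 2 * ((d k - z k) * h k * w k))
  (w := fun k => h k ^+ 2 * w k) (t := t)); last first.
  by move=> k; rewrite /comb; ring.
by rewrite -!mulr_sumr; field; rewrite gt_eqF.
Qed.

(** Each weight is at least [eta]. The lower bound is free of [d], hence the same for all
    iterates. *)
Lemma Ec_ge c d : mu / 2 * eta * bil KK c c <= Ec c d.
Proof.
rewrite /Ec -[leLHS]add0r lerD ?mulr_ge0// -mulrA ler_pM2l ?divr_gt0//.
rewrite KK_sum mulr_sumr ler_sum// => k _.
by rewrite ler_wpM2r// lerDr sqr_ge0.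
Qed.

Lemma Ec_ge0 c d : 0 <= Ec c d.
Proof. by rewrite (le_trans _ (Ec_ge c d))// !mulr_ge0 ?KK_ge0 ?invr_ge0//. Qed.

Lemma Dc_ge0 d : 0 <= Dc d.
Proof.
apply: mulr_ge0 => //.
apply: addr_ge0; apply: mulr_ge0; rewrite ?KK_ge0 ?invr_ge0 ?mulr_ge0//.
by rewrite sumr_ge0// => k _; rewrite mulr_ge0 ?sqr_ge0.
Qed.

Lemma Jc_ge0 z c d : 0 <= Jc z c d.
Proof.
apply: addr_ge0; first by rewrite addr_ge0 ?Ec_ge0 ?Dc_ge0.
apply: mulr_ge0; rewrite ?divr_ge0//.
by rewrite sumr_ge0// => k _; rewrite mulr_ge0 ?sqr_ge0.
Qed.

(** The penalty alone supplies the strong convexity; the remaining terms are nonnegative. *)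
Lemma Qc_ge c h k : gam / 2 * (h k ^+ 2 * w k) <= Qc c h.
Proof.
rewrite /Qc -[leLHS]add0r lerD//; last first.
  rewrite ler_pM2l ?divr_gt0// (bigD1 k)//= lerDl sumr_ge0// => i _.
  by rewrite mulr_ge0 ?sqr_ge0.
apply: addr_ge0; apply: mulr_ge0; rewrite ?divr_ge0//.
  by rewrite sumr_ge0// => i _; rewrite mulr_ge0 ?sqr_ge0.
apply: addr_ge0; apply: mulr_ge0; rewrite ?KK_ge0 ?invr_ge0 ?mulr_ge0//.
by rewrite sumr_ge0// => i _; rewrite mulr_ge0 ?sqr_ge0.
Qed.

(** The constraint set is convex: the segment from [d] to [e] is admissible, so [Jc] has nonnegative
    slope at its start. *)
Lemma argmin_Jc_dJc z c d e : (forall k, d k <= z k) -> (forall k, e k <= z k) ->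
  (forall e, (forall k, e k <= z k) -> Jc z c d <= Jc z c e) ->
  0 <= dJc z c d (fun k => e k - d k).
Proof.
move=> dz ez dmin; apply: (@slope_ge0 _ _ (Qc c (fun k => e k - d k))) => t /andP[t0 t1].
suff /dmin : forall k, comb d t (fun k => e k - d k) k <= z k by rewrite Jc_comb; lra.
move=> k; rewrite /comb.
have -> : d k + t * (e k - d k) = (1 - t) * d k + t * e k by ring.
have -> : z k = (1 - t) * z k + t * z k by ring.
by rewrite lerD// ler_wpM2l// subr_ge0.
Qed.

(** The expansion of [Jc] from [d] to [e] is exact: its linear term is nonnegative by minimality and
    its quadratic term is bounded below by [Qc_ge]. *)
Lemma argmin_Jc_strong z c d e : (forall k, d k <= z k) -> (forall k, e k <= z k) ->
  (forall e, (forall k, e k <= z k) -> Jc z c d <= Jc z c e) ->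
  forall k, Jc z c d + gam / 2 * ((e k - d k) ^+ 2 * w k) <= Jc z c e.
Proof.
move=> dz ez dmin k.
have -> : Jc z c e = Jc z c (comb d 1 (fun k => e k - d k)).
  by congr Jc; apply/funext => i; rewrite /comb mul1r addrC subrK.
have := argmin_Jc_dJc dz ez dmin; have := Qc_ge c (fun k => e k - d k) k.
by rewrite Jc_comb expr1n !mul1r; lra.
Qed.

Hypothesis KK_offdiag : forall l m, l != m -> KK l m <= 0.

(** Write d = p - n with positive and negative parts. Since p_k n_k = 0, the cross term sees only
    off-diagonal entries and is at most 0, so both -2 KK(p, n) and KK(n, n) are nonnegative. *)
Lemma bil_KK_pos d :
  bil KK (fun k => Num.max (d k) 0) (fun k => Num.max (d k) 0) <= bil KK d d.
Proof.
pose p k := Num.max (d k) 0; pose n k := Num.max (- d k) 0.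
have dE : d = comb p (-1) n.
  by apply/funext => k; rewrite /comb /p /n; case: (leP (d k) 0); case: (leP (- d k) 0); lra.
rewrite [in leRHS]dE bil_comb2// -/p.
have p0 k : 0 <= p k by rewrite /p le_max lexx orbT.
have n0 k : 0 <= n k by rewrite /n le_max lexx orbT.
have pn0 k : p k * n k = 0.
  by rewrite /p /n; case: (leP (d k) 0); case: (leP (- d k) 0); nra.
have := KK_ge0 n; suff : bil KK p n <= 0 by lra.
apply: sumr_le0 => l _; apply: sumr_le0 => m _.
have [->|lm] := eqVneq l m; first by rewrite -mulrA pn0 mulr0.
by rewrite -mulrA mulr_le0_ge0 ?KK_offdiag// mulr_ge0.
Qed.

Lemma argmin_Jc_ge0 z c d : (forall k, 0 <= z k) -> (forall k, z k <= 1) ->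
  (forall k, d k <= z k) ->
  (forall e, (forall k, e k <= z k) -> Jc z c d <= Jc z c e) ->
  forall k, 0 <= d k.
Proof.
move=> z0 z1 dz dmin.
pose p k := Num.max (d k) 0.
have pz k : p k <= z k by rewrite /p ge_max dz z0.
have := dmin p pz; rewrite /Jc /Ec /Dc.
have h1 : \sum_k (p k ^+ 2 + eta) * bil (K k) c c <= \sum_k (d k ^+ 2 + eta) * bil (K k) c c.
  apply: ler_sum => k _; rewrite ler_wpM2r// lerD2r.
  by rewrite /p; case: (leP (d k) 0); nra.
have h2 : \sum_k (1 - p k) ^+ 2 * s k <= \sum_k (1 - d k) ^+ 2 * s k.
  apply: ler_sum => k _; rewrite ler_wpM2r//.
  by rewrite /p; case: (leP (d k) 0); nra.
have h3 := bil_KK_pos d; rewrite -/p in h3.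
have {}h1 : mu / 2 * (\sum_k (p k ^+ 2 + eta) * bil (K k) c c) <=
  mu / 2 * (\sum_k (d k ^+ 2 + eta) * bil (K k) c c).
  by rewrite ler_wpM2l// divr_ge0//.
have {h2 h3}h2 : kappa * ((4 * eps)^-1 * (\sum_k (1 - p k) ^+ 2 * s k) + eps * bil KK p p)
  <= kappa * ((4 * eps)^-1 * (\sum_k (1 - d k) ^+ 2 * s k) + eps * bil KK d d).
  by rewrite ler_wpM2l// lerD// ler_wpM2l// ?invr_ge0 ?mulr_ge0.
move=> h4.
(* The other terms do not increase under truncation, so by minimality the penalty cannot decrease.
   But it does so strictly at a negative coordinate, because z >= 0 and the weights [w] are
   positive. *)
have h5 : gam / 2 * (\sum_k (d k - z k) ^+ 2 * w k) <=
  gam / 2 * (\sum_k (p k - z k) ^+ 2 * w k).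
  by lra.
rewrite ler_pM2l ?divr_gt0// in h5.
move=> k; rewrite leNgt; apply/negP => dk0; move: h5; rewrite leNgt => /negP; apply.
rewrite [ltLHS](bigD1 k)// [ltRHS](bigD1 k)//= ltr_leD//.
  rewrite ltr_pM2r// /p; have := z0 k; case: (leP (d k) 0); nra.
apply: ler_sum => i _; rewrite ler_wpM2r//.
rewrite /p; have := z0 i; case: (leP (d i) 0); nra.
Qed.

Lemma cvg_bil (A : I -> I -> R) (u v : nat -> I -> R) (a b : I -> R) :
  (forall l, (fun j => u j l) @ \oo --> a l) ->
  (forall l, (fun j => v j l) @ \oo --> b l) ->
  (fun j => bil A (u j) (v j)) @ \oo --> bil A a b.
Proof.
move=> ua vb; apply: cvg_sumr => l; apply: cvg_sumr => m.
by apply: cvgM; [apply: cvgM; [exact: cvg_cst|]|].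
Qed.

(** [Cl] stands for the nodal vectors satisfying the boundary condition, an affine set, and [V0] for
    its directions, the vectors with zero boundary values. *)
Variables V0 Cl : (I -> R) -> Prop.
Hypotheses (V0_scale : forall t e, V0 e -> V0 (fun l => t * e l))
  (V0_closed : forall (u : nat -> I -> R) a, (forall j, V0 (u j)) ->
     (forall l, (fun j => u j l) @ \oo --> a l) -> V0 a)
  (V0_definite : forall e, V0 e -> bil KK e e = 0 -> forall l, e l = 0)
  (Cl_sub : forall c c', Cl c -> Cl c' -> V0 (fun l => c l - c' l))
  (Cl_comb : forall c e t, Cl c -> V0 e -> Cl (comb c t e)).

(** By compactness: if coercivity failed for every constant 1/(n+1), normalized counterexamples
    would accumulate at a nonzero element of [V0] on which the form vanishes. *)
Lemma bil_KK_coercive : exists2 m : R, 0 < m &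
  forall e, V0 e -> forall l, m * e l ^+ 2 <= bil KK e e.
Proof.
apply: contrapT => ncoer.
have bad (n : nat) : exists e : I -> R, [/\ V0 e, forall l, `|e l| <= 1,
    1 <= \sum_l e l ^+ 2 & bil KK e e <= n.+1%:R^-1].
  apply: contrapT => nbad; apply: ncoer; exists n.+1%:R^-1 => // e Ve l.
  rewrite leNgt; apply/negP => el; apply: nbad.
  (* Division by the coordinate of largest modulus bounds all coordinates by 1 and keeps the sum of
     squares at least 1, a closed condition that excludes the zero limit. *)
  have [l0 _ maxl0] := @arg_maxP _ _ I l xpredT (fun k => `|e k|) isT.
  have {}maxl0 k : `|e k| <= `|e l0| by exact: maxl0.
  have e00 : e l0 != 0.
    apply/eqP => e0; have := maxl0 l; rewrite e0 normr0 normr_le0 => /eqP el0.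
    by move: el; rewrite el0 expr0n mulr0 ltNge KK_ge0.
  have bilZ : bil KK (fun k => (e l0)^-1 * e k) (fun k => (e l0)^-1 * e k) =
      (e l0 ^+ 2)^-1 * bil KK e e.
    rewrite /bil mulr_sumr; apply: eq_bigr => i _; rewrite mulr_sumr.
    by apply: eq_bigr => k _; field.
  exists (fun k => (e l0)^-1 * e k); split.
  - exact: V0_scale.
  - move=> k; rewrite normrM normfV ler_pdivrMl ?normr_gt0// mulr1.
    exact: (maxl0 k).
  - rewrite (bigD1 l0)//= mulVf// expr1n lerDl sumr_ge0// => k _.
    exact: sqr_ge0.
  - have e02 : 0 < e l0 ^+ 2 by rewrite exprn_even_gt0.
    rewrite bilZ ler_pdivrMl// mulrC (le_trans (ltW el))// ler_wpM2l//.
    by rewrite -(real_normK (num_real (e l))) -(real_normK (num_real (e l0))) lerXn2r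
      ?nnegrE// (maxl0 l).
have [u hu] := choice bad.
have [|f hf [a ua]] := @bolzano_weierstrass_fin R I u 1; first by move=> j l;
  have [_ + _ _] := hu j; exact.
have Va : V0 a by apply: (V0_closed _ ua) => j; have [] := hu (f j).
have a1 : 1 <= \sum_l a l ^+ 2.
  have cs : (fun j => \sum_l u (f j) l ^+ 2) @ \oo --> \sum_l a l ^+ 2.
    by apply: cvg_sumr => l; rewrite expr2; apply: cvgM.
  by apply: (cvgr_to_ge cs); apply: nearW => j; have [] := hu (f j).
have a0 : bil KK a a = 0.
  apply/eqP; rewrite eq_le KK_ge0 andbT.
  have ch : (harmonic \o f) @ \oo --> (0 : R) := cvg_subseq hf cvg_harmonic.
  apply: (ler_cvg_to (@cvg_bil KK _ _ _ _ ua ua) ch); apply: nearW => j.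
  by have [] := hu (f j).
have az := V0_definite Va a0.
by move: a1; rewrite big1 ?ler10// => l _; rewrite az expr0n.
Qed.

Variables (z : I -> R) (c d : nat -> I -> R).
Hypotheses (z_ge0 : forall k, 0 <= z k) (z_le1 : forall k, z k <= 1)
  (d0 : forall k, d 0%N k = z k)
  (c_Cl : forall j, Cl (c j.+1))
  (c_min : forall j e, Cl e -> Ec (c j.+1) (d j) <= Ec e (d j))
  (d_le : forall j k, d j.+1 k <= z k)
  (d_min : forall j e, (forall k, e k <= z k) ->
     Jc z (c j.+1) (d j.+1) <= Jc z (c j.+1) e).

Lemma iterate_le j k : d j k <= z k.
Proof. by case: j => [|j]; rewrite ?d0// d_le. Qed.

Lemma iterate_ge0 j k : 0 <= d j k.
Proof.
case: j => [|j]; first by rewrite d0.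
by apply: (argmin_Jc_ge0 z_ge0 z_le1 (d_le j)); exact: d_min.
Qed.

Lemma iterate_increment_cvg0 k : (fun j => d j.+1 k - d j k) @ \oo --> (0 : R).
Proof.
(* The first increment is dropped: [c 0] comes from the previous boundary datum and need not be a
   competitor, so energies are compared from [c 1] on. *)
rewrite -cvg_shiftS /=; apply: sqr_cvg0.
pose G j := Jc z (c j.+1) (d j.+1).
have Gdec j : gam / 2 * ((d j.+2 k - d j.+1 k) ^+ 2 * w k) <= G j - G j.+1.
  have h1 : Ec (c j.+2) (d j.+1) <= Ec (c j.+1) (d j.+1) by exact: c_min.
  (* The previous iterate [d j.+1] serves as competitor for [d j.+2]; [h1] then replaces [c j.+2] by
     [c j.+1], since the terms of [Jc] outside [Ec] do not involve [c]. *)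
  have h2 := argmin_Jc_strong (d_le j.+1) (d_le j) (d_min j.+1) k.
  rewrite lerBrDr addrC -sqrrN opprB (le_trans h2)// /G /Jc.
  by rewrite !lerD2r.
have nG : {homo G : n m / (n <= m)%N >-> m <= n}.
  apply/nonincreasing_seqP => j; rewrite -subr_ge0 (le_trans _ (Gdec j))//.
  apply: mulr_ge0; first exact: divr_ge0.
  by apply: mulr_ge0 => //; exact: sqr_ge0.
have cG : cvgn G.
  apply: nonincreasing_is_cvgn => //; exists 0 => _ [j _ <-].
  exact: Jc_ge0.
have dG : (fun j => (gam / 2 * w k)^-1 * (G j - G j.+1)) @ \oo --> (0 : R).
  rewrite -[X in _ --> X](mulr0 (gam / 2 * w k)^-1); apply: cvgM; first exact: cvg_cst.
  by rewrite -[X in _ --> X](subrr (limn G)); apply: cvgB => //; rewrite cvg_shiftS.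
apply: (squeeze_cvgr _ (cvg_cst 0) dG); apply: nearW => j.
rewrite sqr_ge0 /= ler_pdivlMl ?mulr_gt0//.
by apply: le_trans (Gdec j); rewrite -[leLHS]mulrA (mulrC (w k)).
Qed.

Lemma iterate_bounded : exists M, forall j l, `|c j.+1 l| <= M.
Proof.
have [m m0 hm] := bil_KK_coercive.
(* [c 1] is an admissible competitor at every step, and 0 <= d <= 1 bounds its energy independently
   of the step. *)
pose C0 := Ec (c 1) (fun=> 1).
have Ec1 j : Ec (c 1) (d j) <= C0.
  rewrite /C0 /Ec lerD2l ler_wpM2l// ?divr_ge0// ler_sum// => k _.
  rewrite ler_wpM2r// lerD2r expr1n expr_le1 ?iterate_ge0//.
  exact: le_trans (iterate_le j k) (z_le1 k).
pose a := mu / 2 * eta; have a0 : 0 < a by rewrite !mulr_gt0 ?invr_gt0.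
have q j : bil KK (c j.+1) (c j.+1) <= C0 / a.
  rewrite ler_pdivlMr// mulrC (le_trans (Ec_ge _ (d j)))// (le_trans (c_min j (c_Cl 0)))//.
(* The 4 comes from KK(x - y) <= 2 KK(x) + 2 KK(y), each form being at most C0 / a. Below, x^2 <= M2
   is weakened to |x| <= |M2| + 1, which avoids a square root. *)
pose M2 := m^-1 * (4 * (C0 / a)).
exists (`|M2| + 1 + \sum_l `|c 1 l|) => j l.
have : bil KK (comb (c j.+1) (-1) (c 1)) (comb (c j.+1) (-1) (c 1)) <= 4 * (C0 / a).
  have := KK_ge0 (comb (c j.+1) 1 (c 1)); rewrite !bil_comb2//.
  by have := q j; have := q 0%N; lra.
have -> : comb (c j.+1) (-1) (c 1) = fun l => c j.+1 l - c 1 l.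
  by apply/funext => i; rewrite /comb mulN1r.
move=> /(le_trans (hm _ (Cl_sub (c_Cl j) (c_Cl 0)) l)).
rewrite -ler_pdivlMl// -/M2 => h2.
have h3 : `|c j.+1 l - c 1 l| <= `|M2| + 1.
  rewrite -(@ler_pXn2r _ 2)// ?nnegrE ?addr_ge0// real_normK ?num_real//.
  rewrite (le_trans h2)//; have := ler_norm M2; have := normr_ge0 M2; nra.
rewrite -[c j.+1 l](subrK (c 1 l)) (le_trans (ler_normD _ _))// lerD//.
by rewrite (bigD1 l)//= lerDl sumr_ge0.
Qed.

Theorem alternating_minimization_cvg :
  exists2 f : nat -> nat, {homo f : m n / (m < n)%N} &
  exists (cl dl : I -> R), [/\
    forall l, (fun j => c (f j) l) @ \oo --> cl l,
    forall l, (fun j => d (f j) l) @ \oo --> dl l,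
    forall e, V0 e -> dEc cl dl e = 0 &
    forall e, (forall k, e k <= z k) -> 0 <= dJc z cl dl (fun k => e k - dl k)].
Proof.
have [M hM] := iterate_bounded.
(* The disjoint sum of index types yields a single subsequence for both variables. *)
pose u j (i : I + I) := match i with inl l => c j.+1 l | inr l => d j.+1 l end.
have [|f hf [a ua]] := @bolzano_weierstrass_fin R (I + I)%type u (`|M| + 1).
  move=> j [l|l] /=; first by rewrite (le_trans (hM _ _))// (le_trans (ler_norm M))// lerDl.
  rewrite ger0_norm ?iterate_ge0// (le_trans (d_le j l))// (le_trans (z_le1 l))// lerDr//.
pose cl l := a (inl l); pose dl l := a (inr l).
have cc l : (fun j => c (f j).+1 l) @ \oo --> cl l := ua (inl l).
have dd l : (fun j => d (f j).+1 l) @ \oo --> dl l := ua (inr l).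
(* [c (f j).+1] minimizes against the older [d (f j)], so this sequence also enters the stationarity
   condition and must have the same limit. *)
have dd' l : (fun j => d (f j) l) @ \oo --> dl l.
  have -> : (fun j => d (f j) l) =
      (fun j => d (f j).+1 l) \- ((fun j => d j.+1 l - d j l) \o f).
    by apply/funext => j /=; rewrite opprB addrC subrK.
  rewrite -[X in _ --> X]subr0.
  exact: cvgB (dd l) (cvg_subseq hf (iterate_increment_cvg0 l)).
exists (fun j => (f j).+1); first by move=> m n mn; rewrite ltnS hf.
exists cl, dl; split => //.
- move=> e Ve.
  have h0 j : dEc (c (f j).+1) (d (f j)) e = 0.
    apply: (@slope_eq0 _ _ (Ec e (d (f j)))) => t.
    have := c_min (f j) (Cl_comb t (c_Cl (f j)) Ve).
    by rewrite Ec_comb; lra.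
  have cvE : (fun j => dEc (c (f j).+1) (d (f j)) e) @ \oo --> dEc cl dl e.
    apply: cvgD; first by apply: cvg_bil => // l; exact: cvg_cst.
    apply: cvgM; first exact: cvg_cst.
    apply: cvg_sumr => k; apply: cvgM.
      by apply: cvgD; [rewrite expr2; apply: cvgM|exact: cvg_cst].
    by apply: cvg_bil => // l; exact: cvg_cst.
  have : (fun j => dEc (c (f j).+1) (d (f j)) e) = cst 0 by apply/funext => j; exact: h0.
  move=> h1; rewrite h1 in cvE; apply: (cvg_unique _ cvE (cvg_cst 0)).
  exact: Rhausdorff.
- move=> e ez.
  have h0 j : 0 <= dJc z (c (f j).+1) (d (f j).+1) (fun k => e k - d (f j).+1 k).
    exact: argmin_Jc_dJc (d_le (f j)) ez (d_min (f j)).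
  have de k : (fun j => e k - d (f j).+1 k) @ \oo --> e k - dl k.
    by apply: cvgB => //; exact: cvg_cst.
  have cvJ : (fun j => dJc z (c (f j).+1) (d (f j).+1) (fun k => e k - d (f j).+1 k))
      @ \oo --> dJc z cl dl (fun k => e k - dl k); last first.
    by apply: (cvgr_to_ge cvJ); apply: nearW => j; exact: h0.
  rewrite /dJc; apply: cvgD; [apply: cvgD|].
  + apply: cvgM; first exact: cvg_cst.
    by apply: cvg_sumr => k; apply: cvgM; [apply: cvgM|apply: cvg_bil].
  + apply: cvgM; first exact: cvg_cst.
    apply: cvgD; (apply: cvgM; first exact: cvg_cst).
      apply: cvg_sumr => k; apply: cvgM; last exact: cvg_cst.
      by apply: cvgM => //; apply: cvgB => //; exact: cvg_cst.
    exact: cvg_bil.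
  + apply: cvgM; first exact: cvg_cst.
    apply: cvg_sumr => k; apply: cvgM; last exact: cvg_cst.
    by apply: cvgM => //; apply: cvgB => //; exact: cvg_cst.
Qed.

End alternating_minimization_coefficients.

(** * Barycentric coordinates on the triangulation *)

Definition aff (R : realType) (a : R * R * R) (x : R * R) : R :=
  a.1.1 + a.1.2 * x.1 + a.2 * x.2.

Definition slope (R : realType) (a : R * R * R) (i : 'I_2) : R :=
  if i == 0 then a.1.2 else a.2.

Lemma aff_continuous (R : realType) (a : R * R * R) : continuous (aff a).
Proof.
move=> x; rewrite /aff; apply: cvgD; first apply: cvgD; first exact: cvg_cst.
  by apply: cvgM; [exact: cvg_cst|exact: cvg_fst].
by apply: cvgM; [exact: cvg_cst|exact: cvg_snd].
Qed.

Lemma aff_sum (R : realType) (I : finType) (a : R * R * R) (c : I -> R)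
  (x : I -> R * R) : \sum_l c l = 1 ->
  aff a (\sum_l c l *: x l) = \sum_l c l * aff a (x l).
Proof.
move=> c1; rewrite /aff (raddf_sum fst) (raddf_sum snd) /=.
rewrite !mulr_sumr -[X in X + _ + _]mulr1 -c1 mulr_sumr -!big_split /=.
by apply: eq_bigr => l _; rewrite /GRing.scale /=; ring.
Qed.

Lemma aff_line (R : realType) (a : R * R * R) (x : R * R) (i : 'I_2) (h : R) :
  aff a (h *: basis_vec R i + x) = aff a x + h * slope a i.
Proof.
rewrite /aff /basis_vec /slope; case: ifP => _ /=;
  by rewrite /GRing.scale/=; ring.
Qed.

Lemma near_aff_derive (R : realType) (u : R * R -> R) (a : R * R * R) (x : R * R)
  (i : 'I_2) : (\forall y \near x, u y = aff a y) ->
  'D_(basis_vec R i) u x = slope a i.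
Proof.
move=> ua; apply: cvg_lim => //.
have ux := nbhs_singleton ua.
have cx : (fun h : R => h *: basis_vec R i + x) @ (0 : R)^' --> x.
  rewrite -[X in _ --> X]add0r -[X in X + x](scale0r (basis_vec R i)).
  apply: cvgD; last exact: cvg_cst.
  by apply: cvgZr_tmp; exact: nbhs_dnbhs.
suff nE : {near (0 : R)^', cst (slope a i) =1 (fun h => h^-1 *: ((u \o shift x) (h *:
  basis_vec R i) - u x))}.
  exact: cvg_trans (near_eq_cvg nE) (cvg_cst _).
near=> h.
have h0 : h != 0 by near: h; exact: nbhs_dnbhs_neq.
have uh : u (h *: basis_vec R i + x) = aff a (h *: basis_vec R i + x).
  by near: h; exact: (cx _ ua).
rewrite /= ux uh aff_line addrAC subrr add0r.
by rewrite /GRing.scale/= mulrA mulVf// mul1r.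
Unshelve. all: by end_near. Qed.

Section triangulation_geometry.
Context {R : realType} {om : set (R * R)} (M : triangulation om).
Notation n := (nvert M).
Notation hullM := (hull (vert (t := M))).
Implicit Types (T : {set 'I_n}) (l m : 'I_n) (x y : R * R).

Lemma vert_hull T l : l \in T -> hullM T (vert l).
Proof.
move=> lT; exists (fun m => (m == l)%:R); split.
- by move=> m; rewrite ler0n.
- by move=> m mT; case: eqP => // ml; rewrite ml lT in mT.
- by rewrite (bigD1 l)//= eqxx big1 ?addr0// => m /negbTE ->.
- by rewrite (bigD1 l)//= eqxx scale1r big1 ?addr0// => m /negbTE ->; rewrite scale0r.
Qed.

Lemma hull_closure T x : T \in elements M -> hullM T x -> closure om x.
Proof. by move=> TM xT; rewrite (tri_cover M); exists T. Qed.

Lemma closure_hull x : closure om x -> exists2 T, T \in elements M & hullM T x.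
Proof. by rewrite (tri_cover M). Qed.

Lemma vert_closure l : closure om (vert l).
Proof. by have [T TM lT] := tri_vert l; exact: hull_closure TM (vert_hull lT). Qed.

(** The matrix with rows (1, x, y) over the three vertices is invertible, because a vector in its
    left kernel is an affine dependence between the vertices. The weights may be negative, as [y] is
    any point of the plane. *)
Lemma barycentric T y : T \in elements M -> exists c : 'I_n -> R,
  [/\ forall l, l \notin T -> c l = 0, \sum_l c l = 1 & y = \sum_l c l *: vert l].
Proof.
move=> TM; have T3 := tri_card TM.
pose e (i : 'I_3) : 'I_n := enum_val (cast_ord (esym T3) i).
have e_inj : injective e by move=> i j /enum_val_inj /cast_ord_inj.
have eT i : e i \in T by exact: enum_valP.
pose ext (p : 'rV[R]_3) l := \sum_i (e i == l)%:R * p 0 i.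
have ext0 p l : l \notin T -> ext p l = 0.
  move=> lT; rewrite /ext big1// => i _; case: eqP => [il|_]; last by rewrite mul0r.
  by rewrite -il eT in lT.
have extE (V : lmodType R) p (f : 'I_n -> V) :
    \sum_l ext p l *: f l = \sum_i p 0 i *: f (e i).
  under eq_bigr do rewrite scaler_suml.
  rewrite exchange_big; apply: eq_bigr => i _ /=.
  rewrite (bigD1 (e i))//= eqxx mul1r big1 ?addr0// => l li.
  by rewrite eq_sym (negbTE li) mul0r scale0r.
have ext_e p i : ext p (e i) = p 0 i.
  rewrite /ext (bigD1 i)//= eqxx mul1r big1 ?addr0// => j ji.
  by rewrite (inj_eq e_inj) (negbTE ji) mul0r.
have ext1 p : \sum_l ext p l = \sum_i p 0 i.
  have := extE R^o p (fun=> 1); rewrite /GRing.scale/=.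
  by under eq_bigr do rewrite mulr1; under [RHS]eq_bigr do rewrite mulr1.
pose coor x (j : 'I_3) : R := if j == 0 then 1 else if j == 1 then x.1 else x.2.
pose V : 'M[R]_3 := \matrix_(i, j) coor (vert (e i)) j.
have VE (p : 'rV[R]_3) x : p *m V = \row_j coor x j ->
    \sum_l ext p l = 1 /\ x = \sum_l ext p l *: vert l.
  move=> /rowP h; rewrite ext1 extE.
  have := (h 0, h 1, h 2); rewrite !mxE /coor /= => -[[h0 h1] h2].
  split; first by rewrite -[RHS]h0; apply: eq_bigr => i _; rewrite !mxE /coor mulr1.
  apply/pair_eqP; rewrite /pair_eq.
  rewrite (raddf_sum fst) (raddf_sum snd) /=; apply/andP; split; apply/eqP.
    by rewrite -[LHS]h1; apply: eq_bigr => i _; rewrite !mxE /coor.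
  by rewrite -[LHS]h2; apply: eq_bigr => i _; rewrite !mxE /coor.
have Vunit : V \in unitmx.
  rewrite -row_free_unit; apply/inj_row_free => p pV0.
  have pV j : \sum_i p 0 i * coor (vert (e i)) j = 0.
    by have /rowP/(_ j) := pV0; rewrite !mxE => pj; rewrite -[RHS]pj; apply: eq_bigr => i _;
      rewrite !mxE.
  have extz := @tri_nondegenerate _ _ M T TM (ext p) (ext0 p).
  apply/rowP => i; rewrite !mxE -ext_e; apply: extz.
  - by rewrite ext1 -[RHS](pV 0); apply: eq_bigr => k _; rewrite /coor mulr1.
  - rewrite extE; apply/pair_eqP; rewrite /pair_eq.
    rewrite (raddf_sum fst) (raddf_sum snd) /=; apply/andP; split; apply/eqP.
      by rewrite -[RHS](pV 1).
    by rewrite -[RHS](pV 2).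
pose p := (\row_j coor y j) *m invmx V.
have [p1 py] : \sum_l ext p l = 1 /\ y = \sum_l ext p l *: vert l.
  by apply: VE; rewrite mulmxKV.
by exists (ext p); split => // l; exact: ext0.
Qed.

Variable xi : 'I_n -> R * R -> R.
Hypothesis hxi : lagrange_basis xi.

(** Being affine on the whole plane, [A T l] is a barycentric coordinate outside [T] as well; the
    signs of these coordinates decide membership in [T]. *)
Variable A : {set 'I_n} -> 'I_n -> R * R * R.
Hypothesis hA : forall T l x, T \in elements M -> hullM T x -> xi l x = aff (A T l) x.

Lemma xi_vert l m : xi l (vert m) = (l == m)%:R.
Proof. by have [_] := hxi l; exact. Qed.

Lemma aff_barycentric T (c : 'I_n -> R) m : T \in elements M ->
  (forall l, l \notin T -> c l = 0) -> \sum_l c l = 1 ->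
  aff (A T m) (\sum_l c l *: vert l) = c m.
Proof.
move=> TM c0 c1; rewrite aff_sum// (bigD1 m)//= big1 => [|l lm].
  have [mT|mT] := boolP (m \in T); last by rewrite c0// mul0r addr0.
  by rewrite -hA ?xi_vert ?eqxx ?mulr1 ?addr0//; exact: vert_hull.
have [lT|lT] := boolP (l \in T); last by rewrite c0// mul0r.
by rewrite -hA ?xi_vert 1?eq_sym ?(negbTE lm) ?mulr0//; exact: vert_hull.
Qed.

Lemma aff_notin T m y : T \in elements M -> m \notin T -> aff (A T m) y = 0.
Proof.
move=> TM mT; have [c [c0 c1 ->]] := barycentric y TM.
by rewrite aff_barycentric// c0.
Qed.

Lemma aff_sum1 T y : T \in elements M -> \sum_m aff (A T m) y = 1.
Proof.
move=> TM; have [c [c0 c1 ->]] := barycentric y TM.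
by rewrite -[RHS]c1; apply: eq_bigr => m _; rewrite aff_barycentric.
Qed.

Lemma hullP T y : T \in elements M ->
  hullM T y <-> forall m, m \in T -> 0 <= aff (A T m) y.
Proof.
move=> TM; split.
  by move=> [c [c0 cz c1 ->]] m _; rewrite aff_barycentric.
have [c [c0 c1 ->]] := barycentric y TM => h; exists c; split => // l.
have [lT|lT] := boolP (l \in T); last by rewrite c0.
by have := h l lT; rewrite aff_barycentric.
Qed.

Lemma xi_ge0 l x : closure om x -> 0 <= xi l x.
Proof.
move=> /closure_hull[T TM xT]; rewrite (hA _ TM xT).
have [lT|lT] := boolP (l \in T); last by rewrite aff_notin.
exact: (hullP x TM).1.
Qed.

Lemma xi_sum1 x : closure om x -> \sum_l xi l x = 1.
Proof.
move=> /closure_hull[T TM xT]; rewrite -(aff_sum1 x TM).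
by apply: eq_bigr => l _; exact: hA.
Qed.

Lemma xi_le1 l x : closure om x -> xi l x <= 1.
Proof.
move=> xom; rewrite -(xi_sum1 xom) (bigD1 l)//= lerDl sumr_ge0// => m _.
exact: xi_ge0.
Qed.

Lemma Xh_interp u x : Xh M u -> closure om x ->
  u x = \sum_l u (vert l) * xi l x.
Proof.
move=> [_ uaff] /closure_hull[T TM xT]; have [a0 [a1 [a2 ua]]] := uaff T TM.
have {ua} ua y : hullM T y -> u y = aff (a0, a1, a2) y by exact: ua.
have [c [_ cz c1 xE]] := xT.
have xc m : xi m x = c m by rewrite (hA _ TM xT) xE aff_barycentric.
rewrite ua// {1}xE aff_sum//; apply: eq_bigr => l _; rewrite xc mulrC.
have [lT|lT] := boolP (l \in T); last by rewrite cz// !mulr0.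
by rewrite ua//; exact: vert_hull.
Qed.

Lemma Xh_le_vert u w : Xh M u -> Xh M w ->
  (forall l, u (vert l) <= w (vert l)) ->
  forall x, closure om x -> u x <= w x.
Proof.
move=> Xu Xw uw x xom; rewrite (Xh_interp Xu xom) (Xh_interp Xw xom).
by apply: ler_sum => l _; rewrite ler_wpM2r ?xi_ge0.
Qed.

Definition open_element T : set (R * R) :=
  [set x | forall m, m \in T -> 0 < aff (A T m) x].

Lemma open_element_hull T x : T \in elements M -> open_element T x -> hullM T x.
Proof. by move=> TM xT; apply/(hullP x TM) => m /xT/ltW. Qed.

Lemma open_open_element T : open (open_element T).
Proof.
rewrite openE => x xT; rewrite /interior.
suff : \forall y \near x, forall m, m \in T -> 0 < aff (A T m) y by [].
apply: (@filter_forall _ _ (fun m y => m \in T -> 0 < aff (A T m) y) (nbhs x) _) => m.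
case: (boolP (m \in T)) => [mT|_]; last exact: nearW.
have h : \forall y \near x, 0 < aff (A T m) y.
  exact: (cvgr_gt _ (@aff_continuous _ (A T m) x) _ (xT m mT)).
by near=> y => _; near: y.
Unshelve. all: by end_near. Qed.

(** The barycentre, with weights 1/3, lies in the open element and in the closure of [om]. *)
Lemma open_element_meets T : T \in elements M -> (om `&` open_element T) !=set0.
Proof.
move=> TM; pose c (l : 'I_n) : R := (l \in T)%:R / 3.
have c0 l : l \notin T -> c l = 0 by rewrite /c => /negbTE ->; rewrite mul0r.
have c1 : \sum_l c l = 1.
  rewrite -mulr_suml -natr_sum.
  have -> : (\sum_(l < n) (l \in T) = #|T|)%N.
    by rewrite -sum1_card [RHS]big_mkcond; apply: eq_bigr => l _; case: (l \in T).
  by rewrite (tri_card TM) mulfV.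
pose y := \sum_l c l *: vert l.
have yT : open_element T y.
  by move=> m mT; rewrite aff_barycentric// /c mT divr_gt0.
have ycl : closure om y := hull_closure TM (open_element_hull TM yT).
have /ycl : nbhs y (open_element T) by apply: open_nbhs_nbhs; split => //;
  exact: open_open_element.
by [].
Qed.

(** The full lines supporting the edges rather than the edges themselves: a larger set, but still
    null, and given by equations only. *)
Definition skeleton : set (R * R) :=
  [set x | exists T m, [/\ T \in elements M, m \in T & aff (A T m) x = 0]].

Lemma off_skeleton x : closure om x -> ~ skeleton x ->
  exists2 T, T \in elements M & open_element T x.
Proof.
move=> /closure_hull[T TM xT] xN; exists T => // m mT.
rewrite lt_neqAle (hullP x TM).1// andbT eq_sym; apply/eqP => xm0.
by apply: xN; exists T, m.
Qed.

Lemma skeleton_null : measurable (skeleton : set (measurableTypeR R * measurableTypeR R))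
  /\ leb2 R skeleton = 0%E.
Proof.
pose mu : {measure set (measurableTypeR R * measurableTypeR R) -> \bar R} := leb2 R.
pose s := [seq p <- enum {: {set 'I_n} * 'I_n} | (p.1 \in elements M) && (p.2 \in p.1)].
have -> : skeleton = \bigcup_(p in [set` s]) [set x | aff (A p.1 p.2) x = 0].
  apply/seteqP; split => [x [T [m [TM mT x0]]]|x [[T m]]] /=.
    by exists (T, m) => //=; rewrite mem_filter TM mT mem_enum.
  by rewrite mem_filter => /andP[/andP[/= TM mT] _] x0; exists T, m.
rewrite bigcup_seq big_seq_cond.
apply: (big_ind (fun X : set (R * R) => measurable (X : set (measurableTypeR R *
  measurableTypeR R))
  /\ mu X = 0%E)).
- by split; [exact: measurable0|exact: measure0].
- move=> X Y [mX X0] [mY Y0]; split; first exact: measurableU.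
  by apply/negligibleP; [exact: measurableU|apply: negligibleU; exact/negligibleP].
move=> [T m]; rewrite andbT mem_filter => /andP[/andP[/= TM mT] _]; split.
  rewrite -[X in measurable X]setCK; apply: measurableC; apply: measurable_open2.
  rewrite (_ : ~` _ = aff (A T m) @^-1` [set t | t != 0]).
    by apply: open_comp => [x _|]; [exact: aff_continuous|exact: open_neq].
  by apply/seteqP; split => x /= /eqP.
(* The affine function is not constant: it is 1 at [vert m] and 0 at another vertex of [T]. *)
apply: leb2_line; rewrite -negb_and; apply/negP => /andP[/eqP a1 /eqP a2].
have [m' m'T m'm] : exists2 m', m' \in T & m' != m.
  have : (0 < #|T :\ m|)%N by have := tri_card TM; rewrite (cardsD1 m) mT add1n => -[->].
  by move=> /card_gt0P[m']; rewrite !inE => /andP[]; exists m'.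
have e1 : aff (A T m) (vert m) = 1 by rewrite -hA ?xi_vert ?eqxx//; exact: vert_hull.
have e2 : aff (A T m) (vert m') = 0.
  by rewrite -hA ?xi_vert 1?eq_sym ?(negbTE m'm)//; exact: vert_hull.
by move: e1 e2; rewrite /aff a1 a2 !mul0r !addr0 => -> /eqP; rewrite oner_eq0.
Qed.

Lemma derive_open_element u T x i : Xh M u -> T \in elements M -> open_element T x ->
  'D_(basis_vec R i) u x = \sum_m u (vert m) * slope (A T m) i.
Proof.
move=> Xu TM xT.
pose a := (\sum_m u (vert m) * (A T m).1.1, \sum_m u (vert m) * (A T m).1.2, \sum_m u (vert
  m) * (A T m).2).
rewrite (@near_aff_derive _ _ a).
  by rewrite /slope /a; case: ifP.
have /filterS : nbhs x (open_element T) by apply: open_nbhs_nbhs; split => //;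
  exact: open_open_element.
apply => y /(open_element_hull TM) yT.
rewrite (Xh_interp Xu (hull_closure TM yT)) /aff /a /= !mulr_suml -!big_split /=.
by apply: eq_bigr => m _; rewrite (hA _ TM yT) /aff; ring.
Qed.

(* Otherwise pick, among the vertices carrying a given nonzero value of u, one
   with the largest first coordinate. It lies inside om, so some element
   reaches strictly further to the right; u takes the same value on all of it. *)
Lemma Xh_flat_eq0 u : Xh M u ->
  (forall l, bdry om (vert l) -> u (vert l) = 0) ->
  (forall T i, T \in elements M -> \sum_m u (vert m) * slope (A T m) i = 0) ->
  forall l, u (vert l) = 0.
Proof.
move=> Xu ubdry uflat l0; apply: contrapT => /eqP ul0.
have [l /eqP ul lmax] := @arg_maxP _ _ _ l0 (fun l => u (vert l) == u (vert l0)) (fun l =>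
  (vert l).1) (eqxx _).
have lom : om° (vert l).
  apply: contrapT => nl; suff : u (vert l) = 0 by rewrite ul => /eqP; apply/negP.
  by apply: ubdry; split => //; exact: vert_closure.
have cx : (fun h : R => h *: basis_vec R 0 + vert l) @ (0 : R)^'+ --> vert l.
  rewrite -[X in _ --> X]add0r -[X in X + vert l](scale0r (basis_vec R 0)).
  apply: cvgD; last exact: cvg_cst.
  by apply: cvgZr_tmp; exact: cvg_within.
(* An element missing [vert l] has a barycentric coordinate that is negative there, hence nearby;
   there are finitely many elements. *)
have nT : \forall x \near vert l, forall T, T \in elements M -> hullM T x -> hullM T (vert l).
  apply: (@filter_forall _ _ (fun T x => T \in elements M -> hullM T x ->
    hullM T (vert l)) (nbhs (vert l)) _) => T.
  have [TM|TM] := boolP (T \in elements M); last exact: nearW.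
  have [lT|lT] := pselect (hullM T (vert l)); first exact: nearW.
  have [m mT Am] : exists2 m, m \in T & aff (A T m) (vert l) < 0.
    apply: contrapT => nm; apply: lT; apply/(hullP _ TM) => m mT.
    by rewrite leNgt; apply/negP => am; apply: nm; exists m.
  have nm : \forall x \near vert l, aff (A T m) x < 0.
    exact: (cvgr_lt _ (@aff_continuous _ (A T m) (vert l)) _ Am).
  near=> x => _ /(hullP _ TM)/(_ m mT); rewrite leNgt => /negP[].
  by near: x.
have [h [h0 hom hT]] : exists h : R, [/\ 0 < h, om (h *: basis_vec R 0 + vert l) &
    forall T, T \in elements M -> hullM T (h *: basis_vec R 0 + vert l) -> hullM T (vert l)].
  near (0 : R)^'+ => h; exists h; split.
  - by near: h; exact: nbhs_right_gt.
  - by near: h; exact: (cx _ lom).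
  - by near: h; exact: (cx _ nT).
have [T TM yT] := closure_hull (subset_closure hom).
have lT := hT T TM yT.
pose a := (\sum_m u (vert m) * (A T m).1.1, \sum_m u (vert m) * (A T m).1.2,
           \sum_m u (vert m) * (A T m).2).
have ua y : hullM T y -> u y = a.1.1.
  move=> {}yT; rewrite (Xh_interp Xu (hull_closure TM yT)).
  transitivity (aff a y).
    rewrite /aff /a /= !mulr_suml -!big_split /=.
    by apply: eq_bigr => m _; rewrite (hA _ TM yT) /aff; ring.
  have := (uflat T 0 TM, uflat T 1 TM); rewrite /slope /= => -[a1 a2].
  by rewrite /aff [a.1.2]a1 [a.2]a2 !mul0r !addr0.
have [c [c0 cz c1 yE]] := yT.
(* The point is a convex combination of vertices of [T], all of which carry the value of [u] at
   [vert l] and so lie no further to the right. *)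
have : (h *: basis_vec R 0 + vert l).1 <= (vert l).1.
  rewrite yE (raddf_sum fst) /= -[leRHS]mul1r -c1 mulr_suml ler_sum// => m _.
  have [mT|mT] := boolP (m \in T); last by rewrite cz// /GRing.scale/= !mul0r.
  rewrite /GRing.scale/= ler_wpM2l//; apply: lmax.
  by rewrite (ua _ (vert_hull mT)) -(ua _ lT) ul.
by rewrite /basis_vec eqxx /= gerDr /GRing.scale/= mulr1 leNgt h0.
Unshelve. all: by end_near. Qed.

End triangulation_geometry.

(** * Integration off the skeleton *)

Section bounded_measurable.
Context d {T : measurableType d} {R : realType} (mu : {measure set T -> \bar R}).
Variables (D N : set T).
Hypotheses (mD : measurable D) (mN : measurable N) (D_fin : (mu D < +oo)%E)
  (N0 : mu N = 0%E).

(** Unlike integrability, this property is stable under products, and it leaves the values on [N]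
    free. *)
Definition bounded_mfun (f : T -> R) : Prop :=
  measurable_fun (D `\` N) f /\ exists C, forall x, (D `\` N) x -> `|f x| <= C.

Let mDN : measurable (D `\` N) := measurableD mD mN.

Lemma bm_cst a : bounded_mfun (fun=> a).
Proof. by split; [exact: measurable_cst|exists `|a|]. Qed.

Lemma bmD f g : bounded_mfun f -> bounded_mfun g -> bounded_mfun (fun x => f x + g x).
Proof.
move=> [mf [C fC]] [mg [C' gC']]; split; first exact: measurable_funD.
by exists (C + C') => x Dx; rewrite (le_trans (ler_normD _ _))// lerD ?fC ?gC'.
Qed.

Lemma bmM f g : bounded_mfun f -> bounded_mfun g -> bounded_mfun (fun x => f x * g x).
Proof.
move=> [mf [C fC]] [mg [C' gC']]; split; first exact: measurable_funM.
by exists (C * C') => x Dx; rewrite normrM ler_pM ?fC ?gC'.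
Qed.

Lemma bm_sum (I : finType) (f : I -> T -> R) : (forall i, bounded_mfun (f i)) ->
  bounded_mfun (fun x => \sum_i f i x).
Proof.
move=> bf; elim: (index_enum I) => [|i r ih].
  rewrite (_ : (fun _ => _) = fun=> 0); first exact: bm_cst.
  by apply/funext => x; rewrite big_nil.
rewrite (_ : (fun _ => _) = fun x => f i x + \sum_(j <- r) f j x); first exact: bmD.
by apply/funext => x; rewrite big_cons.
Qed.

Lemma eq_bm f g : (forall x, (D `\` N) x -> f x = g x) -> bounded_mfun f -> bounded_mfun g.
Proof.
move=> fg [mf [C fC]]; split.
  by apply: eq_measurable_fun mf => x; rewrite inE => /fg.
by exists C => x Dx; rewrite -fg// fC.
Qed.

Let I (f : T -> R) : R := \int[mu]_(x in D) f x.

Let IE f : I f = \int[mu]_(x in D `\` N) f x.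
Proof. by rewrite /I /Rintegral (integral_setD_null _ _ mN N0)//. Qed.

Lemma bm_integrable f : bounded_mfun f -> mu.-integrable (D `\` N) (EFin \o f).
Proof.
move=> [mf [C fC]]; apply: measurable_bounded_integrable => //.
  by rewrite (le_lt_trans _ D_fin)// le_measure ?inE.
by exists C; split; [exact: num_real|move=> C' CC' x Dx /=; rewrite (le_trans (fC x Dx))// ltW].
Qed.

Lemma eq_RintegralD_null f g : (forall x, (D `\` N) x -> f x = g x) -> I f = I g.
Proof. by move=> fg; rewrite !IE; apply: eq_Rintegral => x; rewrite inE => /fg. Qed.

Lemma RintegralD_bm f g : bounded_mfun f -> bounded_mfun g ->
  I (fun x => f x + g x) = I f + I g.
Proof. by move=> bf bg; rewrite !IE RintegralD//; exact: bm_integrable. Qed.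

Lemma RintegralZ_bm a f : bounded_mfun f -> I (fun x => a * f x) = a * I f.
Proof. by move=> bf; rewrite !IE RintegralZl//; exact: bm_integrable. Qed.

Lemma Rintegral_sum_bm (J : finType) (f : J -> T -> R) : (forall i, bounded_mfun (f i)) ->
  I (fun x => \sum_i f i x) = \sum_i I (f i).
Proof.
move=> bf; suff [] : bounded_mfun (fun x => \sum_i f i x) /\
    I (fun x => \sum_i f i x) = \sum_i I (f i) by [].
elim: (index_enum J) => [|i r [br ih]].
  rewrite (_ : (fun _ => _) = fun=> 0); last by apply/funext => x; rewrite big_nil.
  split; first exact: bm_cst.
  rewrite big_nil -[RHS](mul0r (I (fun=> 0))) -RintegralZ_bm; last exact: bm_cst.
  by congr I; apply/funext => x; rewrite mul0r.
rewrite (_ : (fun _ => _) = fun x => f i x + \sum_(j <- r) f j x); last first.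
  by apply/funext => x; rewrite big_cons.
by split; [exact: bmD|rewrite RintegralD_bm// big_cons ih].
Qed.

Lemma RintegralD_null_ge0 f : (forall x, (D `\` N) x -> 0 <= f x) -> 0 <= I f.
Proof. by move=> f0; rewrite IE Rintegral_ge0. Qed.

(** If the integral vanished, [f] would be zero almost everywhere on [O] minus [N], where it is
    positive. *)
Lemma RintegralD_null_gt0 f O : bounded_mfun f -> measurable O -> O `<=` D -> (0 < mu O)%E ->
  (forall x, (D `\` N) x -> 0 <= f x) -> (forall x, (O `\` N) x -> 0 < f x) -> 0 < I f.
Proof.
move=> bf mO OD muO f0 fpos.
rewrite lt_neqAle RintegralD_null_ge0// andbT eq_sym; apply/eqP; rewrite IE => I0.
have [mf _] := bf.
have mON : measurable (O `\` N) by exact: measurableD.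
have OND : O `\` N `<=` D `\` N by move=> x [/OD].
have E0 : (\int[mu]_(x in D `\` N) (f x)%:E)%E = 0%E.
  by rewrite -[LHS]fineK ?[X in X%:E]I0//; exact: integrable_fin_num (bm_integrable bf).
have O0 : (\int[mu]_(x in O `\` N) `|(f x)%:E|)%E = 0%E.
  apply/eqP; rewrite eq_le integral_ge0// andbT -E0.
  rewrite [leRHS](_ : _ = \int[mu]_(x in D `\` N) `|(f x)%:E|)%E; last first.
    by apply: eq_integral => x; rewrite inE => xD; rewrite gee0_abs// lee_fin f0.
  apply: (@ge0_subset_integral _ _ _ mu) => //.
  by apply: measurableT_comp => //; exact/measurable_EFinP.
have mfO : measurable_fun (O `\` N) (EFin \o f).
  by apply/measurable_EFinP; exact: measurable_funS mf.
have [/(_ O0) [Z [mZ Z0 hZ]] _] := ae_eq_integral_abs mu mON mfO.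
have : (mu (O `\` N) <= mu Z)%E.
  apply: le_measure; rewrite ?inE// => x ONx; apply: hZ => /= h.
  by have := fpos x ONx; have [] := h ONx => ->; rewrite ltxx.
rewrite Z0 measure_le0 => /eqP ON0.
suff : mu O = 0%E by move=> O00; rewrite O00 ltxx in muO.
apply/negligibleP => //; rewrite -(setUIDK O N); apply: negligibleU; last exact/negligibleP.
by apply: (negligibleS (@subIsetr _ O N)); exact/negligibleP.
Qed.

End bounded_measurable.

(** * Coefficients of the surface *)

Section elasticity_form.
Context {R : realType}.
Implicit Types (C : 'I_2 -> 'I_3 -> R) (b : 'I_2 -> 'I_2 -> R).

Let F C b (k l : 'I_3) := \sum_i \sum_j C i k * C j l * b i j.
Let G C (i j : 'I_2) := \sum_k C i k * C j k.

Let sum2E (f : 'I_2 -> R) : \sum_i f i = f 0 + f 1.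
Proof.
by rewrite !big_ord_recl big_ord0 addr0 (_ : lift ord0 ord0 = 1)//; exact: val_inj.
Qed.

Let sum3E (f : 'I_3 -> R) : \sum_i f i = f 0 + f 1 + f 2.
Proof.
rewrite !big_ord_recl big_ord0 addr0 addrA (_ : lift ord0 ord0 = 1); last exact: val_inj.
by rewrite (_ : lift ord0 (lift ord0 ord0) = 2)//; exact: val_inj.
Qed.

(* With the inverse metric factored as C C^T and F = C^T b C, the three products
   in the elasticity tensor give (tr F)^2, <F, F> and <F, F^T>; the last two add
   up to |F + F^T|^2 / 2. *)
Lemma elasticity_form_ge0 C b (c1 m : R) : 0 <= c1 -> 0 <= m ->
  0 <= \sum_i \sum_j \sum_s \sum_t
    (c1 * G C i j * G C s t + m * (G C i s * G C j t + G C i t * G C j s)) * b i j * b s t.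
Proof.
move=> c0 m0.
suff -> : \sum_i \sum_j \sum_s \sum_t
    (c1 * G C i j * G C s t + m * (G C i s * G C j t + G C i t * G C j s)) * b i j * b s t
    = c1 * (\sum_i \sum_j G C i j * b i j) ^+ 2
      + m * (2^-1 * \sum_k \sum_l (F C b k l + F C b l k) ^+ 2).
  rewrite addr_ge0// mulr_ge0 ?sqr_ge0// mulr_ge0//.
  by rewrite sumr_ge0// => k _; rewrite sumr_ge0// => l _; rewrite sqr_ge0.
transitivity (c1 * (\sum_i \sum_j G C i j * b i j) ^+ 2
   + m * \sum_i \sum_j \sum_s \sum_t (G C i s * G C j t + G C i t * G C j s) * b i j * b s t).
  rewrite !sum2E; move: (G C 0 0) (G C 0 1) (G C 1 0) (G C 1 1).
  by move: (b 0 0) (b 0 1) (b 1 0) (b 1 1) => *; ring.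
congr (_ + m * _); rewrite /F /G !sum2E !sum3E !sum2E.
move: (b 0 0) (b 0 1) (b 1 0) (b 1 1).
by move: (C 0 0) (C 0 1) (C 0 2) (C 1 0) (C 1 1) (C 1 2) => *; field.
Qed.

End elasticity_form.

Section surface_algebra.
Context {R : realType} {om : set (R * R)} (S : surface om).

Definition tangent (x : R * R) : 'M[R]_(2, 3) := \matrix_i d1 S i x.

Lemma dot3E (u v : 'rV[R]_3) : dot3 u v = \sum_k u 0 k * v 0 k.
Proof. by rewrite /dot3 mxE; apply: eq_bigr => k _; rewrite mxE. Qed.

Lemma dot3_ge0 (u : 'rV[R]_3) : 0 <= dot3 u u.
Proof. by rewrite dot3E sumr_ge0// => k _; rewrite -expr2 sqr_ge0. Qed.

Lemma mulmx_tr_eq0 n (w : 'rV[R]_n) : w *m w^T = 0 -> w = 0.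
Proof.
move=> /matrixP/(_ 0 0); rewrite !mxE => w0; apply/rowP => k; rewrite mxE.
have : \sum_j w 0 j ^+ 2 = 0 by rewrite -[RHS]w0; apply: eq_bigr => j _; rewrite mxE expr2.
move/eqP; rewrite psumr_eq0 => [|j _]; last exact: sqr_ge0.
by move/allP/(_ k); rewrite mem_index_enum => /(_ isT); rewrite sqrf_eq0 => /eqP.
Qed.

Lemma metricE x : metric S x = tangent x *m (tangent x)^T.
Proof.
apply/matrixP => i j; rewrite !mxE dot3E; apply: eq_bigr => k _.
by rewrite !mxE.
Qed.

Lemma tr_metric x : (metric S x)^T = metric S x.
Proof. by rewrite metricE trmx_mul trmxK. Qed.

(** The metric is the Gram matrix of the tangent vectors, so a kernel vector v gives |v T|^2 = 0 for
    the tangent matrix T, and the immersion property yields v = 0. *)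
Lemma metric_unit x : closure om x -> metric S x \in unitmx.
Proof.
move=> xom; rewrite -row_free_unit; apply/inj_row_free => v vM0.
apply/eqP; rewrite -(mulmx_free_eq0 _ (phi_immersion S xom)) -/(tangent x).
apply/eqP/mulmx_tr_eq0; rewrite trmx_mul mulmxA -[_ *m tangent x *m _]mulmxA -metricE.
by rewrite vM0 mul0mx.
Qed.

(** Its rows are the contravariant basis vectors; they provide the factor C of the inverse metric in
    [elasticity_form_ge0]. *)
Definition tangent_inv x : 'M[R]_(2, 3) := metric_inv S x *m tangent x.

Lemma tr_metric_inv x : (metric_inv S x)^T = metric_inv S x.
Proof. by rewrite /metric_inv trmx_inv tr_metric. Qed.

Lemma metric_invE x : closure om x ->
  metric_inv S x = tangent_inv x *m (tangent_inv x)^T.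
Proof.
move=> xom; rewrite /tangent_inv trmx_mul tr_metric_inv mulmxA.
by rewrite -[_ *m tangent x *m _]mulmxA -metricE /metric_inv mulVmx ?mul1mx// metric_unit.
Qed.

Lemma det2E (A : 'M[R]_2) : \det A = A 0 0 * A 1 1 - A 0 1 * A 1 0.
Proof.
have l0 : lift (0 : 'I_2) (0 : 'I_1) = 1 by exact: val_inj.
have l1 : lift (1 : 'I_2) (0 : 'I_1) = 0 by exact: val_inj.
rewrite (expand_det_row _ 0) big_ord_recl big_ord1 (_ : lift ord0 ord0 = 1)//.
rewrite /cofactor !det_mx11 !mxE l0 l1 expr0 expr1 mul1r mulN1r.
by rewrite mulrN.
Qed.

(* Lagrange's identity for the two tangent vectors. *)
Lemma det_metricE x : \det (metric S x) =
  dot3 (cross3 (d1 S 0 x) (d1 S 1 x)) (cross3 (d1 S 0 x) (d1 S 1 x)).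
Proof.
rewrite det2E !mxE !dot3E !big_ord_recl !big_ord0 !mxE.
have -> : lift ord0 ord0 = 1 :> 'I_3 by apply: val_inj.
have -> : lift ord0 (lift ord0 ord0) = 2 :> 'I_3 by apply: val_inj.
have -> : ord0 = 0 :> 'I_3 by [].
have -> : 0 + 1 = 1 :> 'I_3 by apply: val_inj.
have -> : 0 + 2 = 2 :> 'I_3 by apply: val_inj.
have -> : 1 + 1 = 2 :> 'I_3 by apply: val_inj.
have -> : 1 + 2 = 0 :> 'I_3 by apply: val_inj.
have -> : 2 + 1 = 0 :> 'I_3 by apply: val_inj.
have -> : 2 + 2 = 1 :> 'I_3 by apply: val_inj.
by ring.
Qed.

Lemma det_metric_gt0 x : closure om x -> 0 < \det (metric S x).
Proof.
move=> xom; rewrite lt_neqAle det_metricE dot3_ge0 andbT eq_sym -det_metricE.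
by rewrite -unitfE -unitmxE metric_unit.
Qed.

Lemma sqrt_a_gt0 x : closure om x -> 0 < sqrt_a S x.
Proof. by move=> xom; rewrite sqrtr_gt0 det_metric_gt0. Qed.

Lemma metric_inv_form x (u w : 'cV[R]_2) : closure om x ->
  u^T *m metric_inv S x *m w = ((tangent_inv x)^T *m u)^T *m ((tangent_inv x)^T *m w).
Proof. by move=> xom; rewrite metric_invE// [in RHS](trmx_mul _ u) trmxK !mulmxA. Qed.

Lemma metric_inv_form_ge0 x (u : 'cV[R]_2) : closure om x ->
  0 <= (u^T *m metric_inv S x *m u) 0 0.
Proof.
move=> xom; rewrite metric_inv_form// mxE sumr_ge0// => k _.
by rewrite mxE -expr2 sqr_ge0.
Qed.

Lemma metric_inv_form_gt0 x (u : 'cV[R]_2) : closure om x -> u != 0 ->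
  0 < (u^T *m metric_inv S x *m u) 0 0.
Proof.
move=> xom u0; rewrite lt_neqAle metric_inv_form_ge0// andbT eq_sym.
apply: contra u0 => /eqP q0.
have Cu0 : (tangent_inv x)^T *m u = 0.
  apply: (can_inj (@trmxK _ _ _)); rewrite [RHS]trmx0; apply: mulmx_tr_eq0.
  by rewrite trmxK -metric_inv_form// [LHS]mx11_scalar q0 raddf0.
have : metric_inv S x *m u = 0 by rewrite metric_invE// -mulmxA Cu0 mulmx0.
by move/(congr1 (mulmx (metric S x))); rewrite mulKVmx ?metric_unit// mulmx0 => ->.
Qed.

Lemma gradAE u w x : gradA S u w x =
  sqrt_a S x * ((grad u x)^T *m metric_inv S x *m grad w x) 0 0.
Proof. by rewrite /gradA /coefA -scalemxAr -scalemxAl mxE. Qed.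

Lemma gradAC u w x : gradA S u w x = gradA S w u x.
Proof.
rewrite !gradAE; congr (_ * _).
transitivity (((grad u x)^T *m metric_inv S x *m grad w x)^T 0 0); first by rewrite [RHS]mxE.
by rewrite !trmx_mul trmxK tr_metric_inv mulmxA.
Qed.

Lemma gradA_ge0 u x : closure om x -> 0 <= gradA S u u x.
Proof.
move=> xom; rewrite gradAE mulr_ge0 ?metric_inv_form_ge0// ltW//.
exact: sqrt_a_gt0.
Qed.

Lemma gradA_gt0 u x : closure om x -> grad u x != 0 -> 0 < gradA S u u x.
Proof. by move=> xom u0; rewrite gradAE mulr_gt0 ?sqrt_a_gt0 ?metric_inv_form_gt0. Qed.

Lemma coefb_ge0 (P : parameters R) x : closure om x -> 0 <= coefb P S x.
Proof.
move=> xom; rewrite /coefb mulr_ge0//; last by rewrite ltW// sqrt_a_gt0.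
have GE i j : metric_inv S x i j = \sum_k tangent_inv x i k * tangent_inv x j k.
  rewrite {1}metric_invE// mxE; apply: eq_bigr => k _; congr (_ * _).
  by rewrite [LHS]mxE.
have m0 := ltW (mu_gt0 P); have l0 := lambda_ge0 P.
have := @elasticity_form_ge0 _ (tangent_inv x) (curvature S x)
  (2 * lambda P * mu P / (lambda P + 2 * mu P)) (mu P) _ m0.
rewrite divr_ge0 ?mulr_ge0 ?addr_ge0 ?mulr_ge0// => /(_ isT).
congr (_ <= _).
apply: eq_bigr => i _; apply: eq_bigr => j _; apply: eq_bigr => s _; apply: eq_bigr => t _.
by rewrite /elasticity !GE.
Qed.

End surface_algebra.

(** * Functions continuous up to the boundary *)

Section continuous_on_closure.
Context {R : realType} (om : set (R * R)).
Hypotheses (om_open : open om) (om_bounded : bounded_set om).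

Definition closure_continuous (f : R * R -> R) : Prop := forall x, closure om x ->
  f y @[y --> within (closure om) (nbhs x)] --> f x.

Lemma cc_within f : {within closure om, continuous f} <-> closure_continuous f.
Proof. exact: subspace_continuousP. Qed.

Lemma cc_cst a : closure_continuous (fun=> a).
Proof. by move=> x _; exact: cvg_cst. Qed.

Lemma ccD f g : closure_continuous f -> closure_continuous g ->
  closure_continuous (fun x => f x + g x).
Proof. by move=> cf cg x xom; apply: cvgD; [exact: cf|exact: cg]. Qed.

Lemma ccN f : closure_continuous f -> closure_continuous (fun x => - f x).
Proof. by move=> cf x xom; apply: cvgN; exact: cf. Qed.

Lemma ccM f g : closure_continuous f -> closure_continuous g ->
  closure_continuous (fun x => f x * g x).
Proof. by move=> cf cg x xom; apply: cvgM; [exact: cf|exact: cg]. Qed.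

Lemma cc_sum (I : finType) (f : I -> R * R -> R) : (forall i, closure_continuous (f i)) ->
  closure_continuous (fun x => \sum_i f i x).
Proof.
by move=> cf x xom; apply: cvg_big => // [|i _]; [exact: add_continuous|exact: cf].
Qed.

Lemma ccV f : (forall x, closure om x -> f x != 0) -> closure_continuous f ->
  closure_continuous (fun x => (f x)^-1).
Proof. by move=> f0 cf x xom; apply: cvgV; [exact: f0|exact: cf]. Qed.

Lemma cc_sqrt f : closure_continuous f -> closure_continuous (fun x => Num.sqrt (f x)).
Proof.
move=> cf x xom; apply: (@continuous_cvg _ _ _ _ _ _ Num.sqrt); last exact: cf.
exact: sqrt_continuous.
Qed.

Lemma cc_coord m n (f : R * R -> 'M[R]_(m, n)) i j :
  {within closure om, continuous f} -> closure_continuous (fun x => f x i j).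
Proof.
move=> /subspace_continuousP cf x xom.
apply: (@continuous_cvg _ _ _ _ _ _ (fun A : 'M[R]_(m, n) => A i j)); last exact: cf.
exact: coord_continuous.
Qed.

Lemma eq_cc f g : (forall x, closure om x -> f x = g x) -> closure_continuous f ->
  closure_continuous g.
Proof.
move=> fg cf x xom; rewrite -fg//.
apply: cvg_trans (cf x xom); apply: near_eq_cvg.
by rewrite near_withinE; near=> y => /fg.
Unshelve. all: by end_near. Qed.

Lemma compact_closure : compact (closure om).
Proof.
have [M0 [_ hM]] := om_bounded.
pose M := `|M0| + 1.
have M0M : M0 < M by rewrite (le_lt_trans (ler_norm _))// ltrDl.
have cK : compact (`[- M, M]%classic `*` `[- M, M]%classic : set (R * R)).
  by apply: compact_setX; exact: segment_compact.
apply: (subclosed_compact _ cK); first exact: closed_closure.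
rewrite closureE => x; apply; split.
  by apply: compact_closed cK; exact: norm_hausdorff.
move=> y /(hM _ M0M) /=; rewrite ge_max => /andP[y1 y2].
by split; rewrite /= in_itv /= -ler_norml.
Qed.

Lemma cc_open_preimage f (V : set R) : closure_continuous f -> open V ->
  open (om `&` f @^-1` V).
Proof.
move=> cf oV; rewrite openE => x [xom fx]; rewrite /interior.
have hV : \forall y \near x, closure om y -> V (f y).
  exact: (cf x (subset_closure xom) V (open_nbhs_nbhs (conj oV fx))).
have hO : \forall y \near x, om y by apply: open_nbhs_nbhs; split.
suff : \forall y \near x, om y /\ V (f y) by [].
near=> y; have yom : om y by near: y.
by split => //; have := subset_closure yom; near: y.
Unshelve. all: by end_near. Qed.

Lemma cc_eq0_closure f : closure_continuous f -> (forall x, om x -> f x = 0) ->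
  forall x, closure om x -> f x = 0.
Proof.
move=> cf f0 x xom; apply/eqP; apply: contraT => fx.
have nf : \forall y \near x, closure om y -> f y != 0.
  exact: (cf x xom [set t | t != 0] (open_nbhs_nbhs (conj (@open_neq _ 0) fx))).
have [y [yom /(_ (subset_closure yom))]] := xom _ nf.
by rewrite f0// eqxx.
Qed.

(** The part of [om] where [f] is nonzero is open and null, hence empty; continuity carries the
    equality to the boundary. *)
Lemma cc_ae_eq0 f : closure_continuous f ->
  (leb2 R).-negligible
    (om `&` [set x | f x != 0] : set (measurableTypeR R * measurableTypeR R)) ->
  forall x, closure om x -> f x = 0.
Proof.
move=> cf nf; apply: cc_eq0_closure => // x xom; apply/eqP; apply: contraT => fx.
have oV := cc_open_preimage cf (@open_neq _ 0).
have : (0 < leb2 R (om `&` [set x | f x != 0%R]))%E.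
  by apply: leb2_open_gt0 => //; exists x.
by rewrite ((negligibleP _ (measurable_open2 oV)).1 nf) ltxx.
Qed.

Lemma cc_bm (N : set (R * R)) f :
  measurable (N : set (measurableTypeR R * measurableTypeR R)) ->
  closure_continuous f -> bounded_mfun (om : set (measurableTypeR R * measurableTypeR R)) N f.
Proof.
move=> mN cf; have mom := measurable_open2 om_open.
split.
  apply: (@measurable_funS _ _ _ _ om) => //.
  apply: (measurability _ (RGenOpens.measurableE R)) => _ [_ [a [b ->] <-]].
  by apply: measurable_open2; apply: cc_open_preimage => //; exact: interval_open.
have [C [_ hC]] := compact_bounded (continuous_compact ((cc_within f).2 cf) compact_closure).
exists (C + 1) => x [xom _]; apply: (hC (C + 1)); first by rewrite ltrDl.
by exists x => //; exact: subset_closure.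
Qed.

End continuous_on_closure.

Section surface_coefficients.
Context {R : realType} (om : set (R * R)) (S : surface om) (P : parameters R).

Lemma cc_dot3 (u v : R * R -> 'rV[R]_3) :
  (forall k, closure_continuous om (fun x => u x 0 k)) ->
  (forall k, closure_continuous om (fun x => v x 0 k)) ->
  closure_continuous om (fun x => dot3 (u x) (v x)).
Proof.
move=> cu cv; apply: (@eq_cc _ _ (fun x => \sum_k u x 0 k * v x 0 k)) => [x _|].
  by rewrite dot3E.
by apply: cc_sum => k; exact: ccM.
Qed.

Lemma cc_metric i j : closure_continuous om (fun x => metric S x i j).
Proof.
apply: (@eq_cc _ _ (fun x => dot3 (d1 S i x) (d1 S j x))) => [x _|]; first by rewrite mxE.
by apply: cc_dot3 => k; apply: cc_coord; exact: d1_cont.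
Qed.

Lemma cc_det_metric : closure_continuous om (fun x => \det (metric S x)).
Proof.
apply: (@eq_cc _ _ (fun x => metric S x 0 0 * metric S x 1 1 - metric S x 0 1 * metric S x 1
  0)) => [x _|].
  by rewrite det2E.
by apply: ccD; [|apply: ccN]; apply: ccM; exact: cc_metric.
Qed.

Lemma cc_sqrt_a : closure_continuous om (sqrt_a S).
Proof. exact: cc_sqrt cc_det_metric. Qed.

(** In ['I_2] the index other than [k] is [k + 1], so every cofactor is a signed entry. *)
Lemma inv2E (A : 'M[R]_2) i j : A \in unitmx ->
  invmx A i j = (\det A)^-1 * ((-1) ^+ (i + j)%N * A (j + 1) (i + 1)).
Proof.
move=> uA; have lE (k : 'I_2) : lift k (0 : 'I_1) = k + 1.
  by apply: val_inj; case: k => [[|[|]]].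
by rewrite /invmx uA !mxE /cofactor det_mx11 !mxE addnC !lE.
Qed.

Lemma cc_metric_inv i j : closure_continuous om (fun x => metric_inv S x i j).
Proof.
apply: (@eq_cc _ _ (fun x => (\det (metric S x))^-1 * ((-1) ^+ (i + j)%N * metric S x (j + 1)
  (i + 1)))) => [x xom|].
  by rewrite /metric_inv inv2E// metric_unit.
apply: ccM; last by apply: ccM; [exact: cc_cst|exact: cc_metric].
by apply: ccV; [move=> x /(det_metric_gt0 S)/lt0r_neq0|exact: cc_det_metric].
Qed.

(** By [det_metricE] the norm of the cross product is [sqrt_a], so the denominator does not vanish
    on the closure. *)
Lemma cc_normal k : closure_continuous om (fun x => normal S x 0 k).
Proof.
pose n x := cross3 (d1 S 0 x) (d1 S 1 x).
have cn l : closure_continuous om (fun x => n x 0 l).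
  apply: (@eq_cc _ _ (fun x => d1 S 0 x 0 (l + 1) * d1 S 1 x 0 (l + 2)
    - d1 S 0 x 0 (l + 2) * d1 S 1 x 0 (l + 1))) => [x _|]; first by rewrite mxE.
  by apply: ccD; [|apply: ccN]; apply: ccM; apply: cc_coord; exact: d1_cont.
apply: (@eq_cc _ _ (fun x => (enorm3 (n x))^-1 * n x 0 k)) => [x _|];
  first by rewrite /normal [RHS]mxE.
apply: ccM; last exact: cn.
apply: ccV; last by apply: cc_sqrt; exact: cc_dot3.
move=> x xom; apply: lt0r_neq0; rewrite sqrtr_gt0 /n -det_metricE.
exact: det_metric_gt0.
Qed.

Lemma cc_curvature i j : closure_continuous om (fun x => curvature S x i j).
Proof.
apply: (@eq_cc _ _ (fun x => dot3 (normal S x) (d2 S i j x))) => [x _|]; first by rewrite mxE.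
by apply: cc_dot3 => k; [exact: cc_normal|apply: cc_coord; exact: d2_cont].
Qed.

Lemma cc_elasticity i j s t : closure_continuous om (fun x => elasticity P S x i j s t).
Proof.
have g := cc_metric_inv.
apply: ccD; first by apply: ccM => //; apply: ccM => //; exact: cc_cst.
by apply: ccM; [exact: cc_cst|apply: ccD; apply: ccM].
Qed.

Lemma cc_coefb : closure_continuous om (coefb P S).
Proof.
apply: ccM; last exact: cc_sqrt_a.
do 4 (apply: cc_sum => ?).
by apply: ccM; [apply: ccM; [exact: cc_elasticity|]|]; exact: cc_curvature.
Qed.

End surface_coefficients.

(** * The space Xh *)

Section linear_combinations.
Context {R : realType} (om : set (R * R)).
Hypotheses (om_open : open om) (om_bounded : bounded_set om).
Notation T2 := (measurableTypeR R * measurableTypeR R)%type.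
Implicit Types f g : R * R -> R.

Let mom : measurable (om : set T2) := measurable_open2 om_open.

Definition L2 f : Prop := measurable_fun (om : set T2) f /\
  (Lnorm (leb2 R) 2%:E (EFin \o (f \_ om)) < +oo)%E.

Lemma L2P f : L2 f <-> (f \_ om : T2 -> R) \in Lfun (leb2 R) 2%:E.
Proof.
split=> [[mf nf]|].
  rewrite inE; apply/andP; split; rewrite inE//=.
  exact/(measurable_restrictT _ mom).
rewrite inE => /andP[]; rewrite !inE /= => mf nf; split => //.
exact/(measurable_restrictT _ mom).
Qed.

Lemma L2_lin f g a b : L2 f -> L2 g -> L2 (fun x => a * f x + b * g x).
Proof.
move=> /L2P Lf /L2P Lg; apply/L2P.
have -> : ((fun x => a * f x + b * g x) \_ om : T2 -> R) =
    (a \o* (f \_ om)) + (b \o* (g \_ om)).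
  have p0 : point = 0 :> R by [].
  apply/funext => x; rewrite !fctE patchE /= !patchE.
  by case: ifP => _; [ring|rewrite p0 !mul0r addr0].
apply: (@Lfun_addr_closed _ _ _ (leb2 R) 2%:E _).2; first by rewrite lee_fin ler1n.
- by apply: Lfun_scale => //; rewrite ler1n.
- by apply: Lfun_scale => //; rewrite ler1n.
Qed.

(** [h] is bounded and |f| <= 1 + f^2, which is integrable on the bounded set [om]. This allows the
    integrals defining weak derivatives to be split. *)
Lemma L2_mul_integrable f h : L2 f -> closure_continuous om h ->
  (leb2 R).-integrable (om : set T2) (EFin \o (fun x => f x * h x)).
Proof.
move=> Lf ch; have [mf _] := Lf.
have [mh [C hC]] := cc_bm om_open om_bounded (@measurable0 _ T2) ch.
rewrite setD0 in mh hC.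
have if2 : (leb2 R).-integrable (om : set T2) (EFin \o (fun x => f x ^+ 2)).
  have := Lfun2_integrable_sqr ((L2P f).1 Lf).
  move/(integrableS measurableT mom (@subsetT _ om)).
  apply: eq_integrable => // x; rewrite inE => xom /=.
  by rewrite patchE mem_set.
have i1 : (leb2 R).-integrable (om : set T2) (EFin \o (fun=> 1)).
  apply: measurable_bounded_integrable => //; first exact: leb2_bounded.
  by exists 1; split => // M M1 x _ /=; rewrite normr1 ltW.
have i2 := integrableZl mom `|C| (integrableD mom i1 if2).
apply: le_integrable i2 => //.
  by apply/measurable_EFinP; exact: measurable_funM.
move=> x xom /=; rewrite lee_fin normrM [leRHS]ger0_norm; last first.
  by rewrite mulr_ge0// addr_ge0// sqr_ge0.
rewrite mulrC ler_pM//; first by rewrite (le_trans (hC x xom))// ler_norm.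
rewrite -(real_normK (num_real (f x))); have := normr_ge0 (f x); nra.
Qed.

Lemma W1p2P f df : W1p om 2 f df <->
  [/\ L2 f, forall i, L2 (df i) & forall i, weak_partial om i f (df i)].
Proof.
have N0 h : (0 <= Lnorm (leb2 R) 2%:E (EFin \o (h \_ om)))%E by exact: Lnorm_ge0.
rewrite /W1p /W1p_norm; split.
  move=> [mf mdf nf wf]; split => //.
    by split => //; apply: le_lt_trans nf; rewrite leeDl// sume_ge0.
  move=> i; split => //; apply: le_lt_trans nf.
  rewrite -[leLHS]add0e leeD// (bigD1 i)//= leeDl// sume_ge0//.
move=> [[mf nf] Ldf wf]; split => //; first by move=> i; have [] := Ldf i.
apply: lte_add_pinfty => //; apply: lte_sum_pinfty => i _.
by have [] := Ldf i.
Qed.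

Lemma H1_lin f g a b : H1 om f -> H1 om g -> H1 om (fun x => a * f x + b * g x).
Proof.
move=> [df /W1p2P[Lf Ldf wf]] [dg /W1p2P[Lg Ldg wg]].
exists (fun i x => a * df i x + b * dg i x); apply/W1p2P; split.
- exact: L2_lin.
- by move=> i; exact: L2_lin.
move=> i psi tpsi; have := (wf i psi tpsi, wg i psi tpsi).
have [/(_ 2) /=[cpsi dpsi] _] := tpsi.
have cc0 : closure_continuous om psi by move=> x _; apply: cvg_within_filter; exact: cpsi.
have cc1 : closure_continuous om (fun x => 'D_(basis_vec R i) psi x).
  by move=> x _; apply: cvg_within_filter; have [_ [+ _]] := dpsi i; exact.
have lin (f1 g1 h : R * R -> R) : L2 f1 -> L2 g1 -> closure_continuous om h ->
    \int[leb2 R]_(x in om) ((a * f1 x + b * g1 x) * h x) =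
    a * \int[leb2 R]_(x in om) (f1 x * h x) + b * \int[leb2 R]_(x in om) (g1 x * h x).
  move=> L1 L1' ch.
  have [i1 i2] := (L2_mul_integrable L1 ch, L2_mul_integrable L1' ch).
  rewrite -!RintegralZl// -RintegralD//; last 2 first.
  - exact: (integrableZl mom a i1).
  - exact: (integrableZl mom b i2).
  by apply: eq_Rintegral => x _; rewrite mulrDl !mulrA.
by rewrite !lin// => -[-> ->]; rewrite !mulrN opprD.
Qed.

Variable M : triangulation om.

Lemma Xh_lin f g a b : Xh M f -> Xh M g -> Xh M (fun x => a * f x + b * g x).
Proof.
move=> [Hf f_aff] [Hg g_aff]; split; first exact: H1_lin.
move=> T TM; have [a0 [a1 [a2 fa]]] := f_aff T TM; have [b0 [b1 [b2 gb]]] := g_aff T TM.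
exists (a * a0 + b * b0), (a * a1 + b * b1), (a * a2 + b * b2) => x xT.
by rewrite fa// gb//; ring.
Qed.

Lemma Xh_sum (I : finType) (f : I -> R * R -> R) (c : I -> R) g : Xh M g ->
  (forall i, Xh M (f i)) -> Xh M (fun x => \sum_i c i * f i x).
Proof.
move=> Xg Xf; elim: (index_enum I) => [|i r ih].
  (* The zero function belongs to Xh as a multiple of the known member [g]. *)
  rewrite (_ : (fun _ => _) = fun x => 0 * g x + 0 * g x); first exact: Xh_lin.
  by apply/funext => x; rewrite big_nil !mul0r addr0.
rewrite (_ : (fun _ => _) = fun x => c i * f i x + 1 * \sum_(j <- r) c j * f j x).
  exact: Xh_lin.
by apply/funext => x; rewrite big_cons mul1r.
Qed.

End linear_combinations.

(** * The discrete functionals *)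

Section discrete_energies.
Context {R : realType} (om : set (R * R)) (S : surface om) (P : parameters R).
Context (M : triangulation om) (xi : 'I_(nvert M) -> R * R -> R).
Hypotheses (om_open : open om) (om_bounded : bounded_set om).
Hypothesis hxi : lagrange_basis xi.
Variable A : {set 'I_(nvert M)} -> 'I_(nvert M) -> R * R * R.
Hypothesis hA : forall T l x, T \in elements M -> hull (vert (t := M)) T x ->
  xi l x = aff (A T l) x.
Notation T2 := (measurableTypeR R * measurableTypeR R)%type.
Notation I := ('I_(nvert M)).
Implicit Types (u w : R * R -> R) (l m k : I) (c d e : I -> R).

Let N : set (R * R) := skeleton A.
Let mom : measurable (om : set T2) := measurable_open2 om_open.
Let mN : measurable (N : set T2) := (skeleton_null hxi hA).1.
Let N0 : leb2 R N = 0%E := (skeleton_null hxi hA).2.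
Let om_fin : (leb2 R om < +oo)%E := leb2_bounded om_bounded mom.

Definition om_integral (f : R * R -> R) : R := \int[leb2 R]_(x in om) f x.
Notation J := om_integral.
Notation bmfN := (bounded_mfun (om : set T2) (N : set T2)).

Let J_eq f g : (forall x, om x -> ~ N x -> f x = g x) -> J f = J g.
Proof. by move=> fg; apply: (eq_RintegralD_null mN N0) => x [/fg]; exact. Qed.

Let JD f g : bmfN f -> bmfN g -> J (fun x => f x + g x) = J f + J g.
Proof. exact: (RintegralD_bm mom mN om_fin N0). Qed.

Let JZ a f : bmfN f -> J (fun x => a * f x) = a * J f.
Proof. exact: (RintegralZ_bm mom mN om_fin N0). Qed.

Let J_sum (K : finType) (f : K -> R * R -> R) : (forall i, bmfN (f i)) ->
  J (fun x => \sum_i f i x) = \sum_i J (f i).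
Proof. exact: (Rintegral_sum_bm mom mN om_fin N0). Qed.

Let J_ge0 f : (forall x, om x -> ~ N x -> 0 <= f x) -> 0 <= J f.
Proof. by move=> f0; apply: (RintegralD_null_ge0 mN N0) => x [/f0]; exact. Qed.

Let J_gt0 f T : T \in elements M -> bmfN f -> (forall x, om x -> ~ N x -> 0 <= f x) ->
  (forall x, om x -> open_element A T x -> 0 < f x) -> 0 < J f.
Proof.
move=> TM bf f0 fpos.
have oO : open (om `&` open_element A T).
  by apply: openI => //; exact: open_open_element.
apply: (RintegralD_null_gt0 mom mN om_fin N0 bf (measurable_open2 oO)).
- by move=> x [].
- by apply: leb2_open_gt0 => //; exact: open_element_meets.
- by move=> x [/f0]; exact.
- by move=> x [[xom xT] _]; exact: fpos.
Qed.

Let omc x : om x -> closure om x := @subset_closure _ om x.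

Lemma xi_bm l : bmfN (xi l).
Proof.
have [[[df [mf _ _ _]] _] _] := hxi l.
split; first by apply: measurable_funS mf => // x [].
exists 1 => x [/omc xom _]; rewrite ger0_norm ?(xi_ge0 hxi hA)//.
exact: (xi_le1 hxi hA).
Qed.

(** Off the skeleton the derivative takes one value per element, so its preimages are finite unions
    of open elements cut down to [om] minus [N]. *)
Lemma derive_bm u i : Xh M u -> bmfN (fun x => 'D_(basis_vec R i) u x).
Proof.
move=> Xu; pose s T := \sum_m u (vert m) * slope (A T m) i.
have Ds T x : T \in elements M -> open_element A T x -> 'D_(basis_vec R i) u x = s T.
  by move=> TM xT; exact: (derive_open_element hxi hA).
split; last first.
  exists (\sum_T `|s T|) => x [/omc xom xN].
  have [T TM xT] := off_skeleton hxi hA xom xN.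
  by rewrite (Ds T)// (bigD1 T)//= lerDl sumr_ge0.
move=> _ Y mY.
rewrite (_ : _ `&` _ = \bigcup_(T in [set T | T \in elements M /\ Y (s T)])
    ((om `&` open_element A T) `\` N)).
  apply: fin_bigcup_measurable; first exact: finite_finset.
  move=> T _; apply: measurableD => //; apply: measurable_open2.
  by apply: openI => //; exact: open_open_element.
apply/seteqP; split => [x [[xom xN] xY]|x [T [TM sY] [[xom xT] xN]]].
  have [T TM xT] := off_skeleton hxi hA (omc xom) xN.
  by exists T => //=; split => //; rewrite -(Ds T x).
by split => //=; rewrite (Ds T).
Qed.

Lemma gradE u x : Xh M u -> om x -> ~ N x ->
  grad u x = \sum_l u (vert l) *: grad (xi l) x.
Proof.
move=> Xu xom xN; have [T TM xT] := off_skeleton hxi hA (omc xom) xN.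
apply/colP => i; rewrite summxE mxE (derive_open_element hxi hA i Xu TM xT).
apply: eq_bigr => l _; rewrite !mxE (derive_open_element hxi hA i _ TM xT);
  last by have [] := hxi l.
congr (_ * _); rewrite (bigD1 l)//= (xi_vert hxi) eqxx mul1r big1 ?addr0// => m ml.
by rewrite (xi_vert hxi) eq_sym (negbTE ml) mul0r.
Qed.

Lemma gradA_sum u w x : Xh M u -> Xh M w -> om x -> ~ N x ->
  gradA S u w x =
  \sum_l \sum_m gradA S (xi l) (xi m) x * u (vert l) * w (vert m).
Proof.
move=> Xu Xw xom xN; rewrite /gradA (gradE Xu)// (gradE Xw)//.
move: (coefA S x) => B; rewrite [(\sum_l _)^T]linear_sum /= !mulmx_suml summxE;
  apply: eq_bigr => l _.
rewrite mulmx_sumr summxE; apply: eq_bigr => m _.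
by rewrite -scalemxAr linearZ /= -!scalemxAl [LHS]mxE [X in _ * X]mxE; ring.
Qed.

Let xiX l : Xh M (xi l). Proof. by have [] := hxi l. Qed.

Lemma coefb_bm : bmfN (coefb P S).
Proof. exact: (cc_bm om_open om_bounded mN (@cc_coefb _ _ S P)). Qed.

Lemma sqrt_a_bm : bmfN (sqrt_a S).
Proof. exact: (cc_bm om_open om_bounded mN (@cc_sqrt_a _ _ S)). Qed.

Lemma gradA_bm u w : Xh M u -> Xh M w -> bmfN (gradA S u w).
Proof.
move=> Xu Xw.
apply: (@eq_bm _ _ _ _ _ (fun x => sqrt_a S x * \sum_j (\sum_i
   'D_(basis_vec R i) u x * metric_inv S x i j) * 'D_(basis_vec R j) w x)).
  move=> x _; rewrite gradAE; congr (_ * _); rewrite mxE; apply: eq_bigr => j _.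
  by rewrite !mxE; congr (_ * _); apply: eq_bigr => i _; rewrite !mxE.
apply: bmM; first exact: sqrt_a_bm.
apply: bm_sum => j; apply: bmM; last exact: derive_bm.
apply: bm_sum => i; apply: bmM; first exact: derive_bm.
exact: (cc_bm om_open om_bounded mN (@cc_metric_inv _ _ S i j)).
Qed.

(** * Matrices and vectors of the nodal energies *)

Definition bend_mx l m : R := J (fun x => coefb P S x * xi l x * xi m x).
Definition wstiff_mx k l m : R := J (fun x => xi k x * gradA S (xi l) (xi m) x).
Definition stiff_mx l m : R := J (gradA S (xi l) (xi m)).
Definition area_vec k : R := J (fun x => xi k x * sqrt_a S x).
Definition mass_vec k : R := J (xi k).

Let J_bil (h : I -> I -> R * R -> R) f c e : (forall l m, bmfN (h l m)) ->
  (forall x, om x -> ~ N x -> f x = \sum_l \sum_m h l m x * c l * e m) ->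
  J f = bil (fun l m => J (h l m)) c e.
Proof.
move=> bh fE.
have bh' l m : bmfN (fun x => c l * e m * h l m x) by apply: bmM => //; exact: bm_cst.
rewrite (J_eq (g := fun x => \sum_l \sum_m c l * e m * h l m x)); last first.
  move=> x xom xN; rewrite fE//; apply: eq_bigr => l _; apply: eq_bigr => m _; ring.
rewrite J_sum => [|l]; last exact: bm_sum.
apply: eq_bigr => l _; rewrite J_sum//; apply: eq_bigr => m _.
by rewrite JZ//; ring.
Qed.

Definition nodal u : I -> R := fun l => u (vert l).

Lemma bend_mxE u w : Xh M u -> Xh M w ->
  J (fun x => coefb P S x * u x * w x) = bil bend_mx (nodal u) (nodal w).
Proof.
move=> Xu Xw; apply: J_bil => [l m|x xom _].
  by apply: bmM; [apply: bmM; [exact: coefb_bm|]|]; exact: xi_bm.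
rewrite (Xh_interp hxi hA Xu (omc xom)) (Xh_interp hxi hA Xw (omc xom)).
rewrite [coefb P S x * _]mulr_sumr mulr_suml; apply: eq_bigr => l _.
by rewrite mulr_sumr; apply: eq_bigr => m _; rewrite /nodal; ring.
Qed.

Lemma stiff_mxE u w : Xh M u -> Xh M w ->
  J (gradA S u w) = bil stiff_mx (nodal u) (nodal w).
Proof.
by move=> Xu Xw; apply: J_bil => [l m|x xom xN]; [exact: gradA_bm|exact: gradA_sum].
Qed.

Lemma wstiff_mxE k u w : Xh M u -> Xh M w ->
  J (fun x => xi k x * gradA S u w x) = bil (wstiff_mx k) (nodal u) (nodal w).
Proof.
move=> Xu Xw; apply: J_bil => [l m|x xom xN].
  by apply: bmM; [exact: xi_bm|exact: gradA_bm].
rewrite (gradA_sum Xu Xw)// mulr_sumr; apply: eq_bigr => l _.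
by rewrite mulr_sumr; apply: eq_bigr => m _; rewrite /nodal; ring.
Qed.

Lemma interp_gradA (f : R * R -> R) u w : Xh M u -> Xh M w ->
  J (fun x => interp xi f x * gradA S u w x) =
  \sum_k f (vert k) * bil (wstiff_mx k) (nodal u) (nodal w).
Proof.
move=> Xu Xw.
rewrite (J_eq (g := fun x => \sum_k f (vert k) * (xi k x * gradA S u w x))); last first.
  by move=> x _ _; rewrite /interp mulr_suml; apply: eq_bigr => k _; ring.
have bk k : bmfN (fun x => xi k x * gradA S u w x).
  by apply: bmM; [exact: xi_bm|exact: gradA_bm].
rewrite J_sum => [|k]; last by apply: bmM => //; exact: bm_cst.
by apply: eq_bigr => k _; rewrite JZ// wstiff_mxE.
Qed.

(** By the partition of unity; it moves [eta] into the nodal values so that [interp_gradA]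
    applies. *)
Lemma interp_add_cst (f : R * R -> R) a x : om x ->
  interp xi f x + a = interp xi (fun y => f y + a) x.
Proof.
move=> /omc xom; rewrite /interp -[X in _ + X]mulr1 -(xi_sum1 hxi hA xom) mulr_sumr.
by rewrite -big_split; apply: eq_bigr => k _ /=; ring.
Qed.

Lemma interp_sqrt_a (f : R * R -> R) :
  J (fun x => interp xi f x * sqrt_a S x) = \sum_k f (vert k) * area_vec k.
Proof.
have bk k : bmfN (fun x => xi k x * sqrt_a S x).
  by apply: bmM; [exact: xi_bm|exact: sqrt_a_bm].
rewrite (J_eq (g := fun x => \sum_k f (vert k) * (xi k x * sqrt_a S x))); last first.
  by move=> x _ _; rewrite /interp mulr_suml; apply: eq_bigr => k _; ring.
rewrite J_sum => [|k]; last by apply: bmM => //; exact: bm_cst.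
by apply: eq_bigr => k _; rewrite JZ.
Qed.

Lemma interp_mass (f : R * R -> R) : J (interp xi f) = \sum_k f (vert k) * mass_vec k.
Proof.
rewrite /interp J_sum => [|k]; last by apply: bmM; [exact: bm_cst|exact: xi_bm].
by apply: eq_bigr => k _; rewrite JZ//; exact: xi_bm.
Qed.

Lemma interp_bm (f : R * R -> R) : bmfN (interp xi f).
Proof. by apply: bm_sum => k; apply: bmM; [exact: bm_cst|exact: xi_bm]. Qed.

Lemma EhE u v : Xh M u ->
  Eh P S xi u v = Ec bend_mx wstiff_mx (mu P) (Defs.eta P) (nodal u) (nodal v).
Proof.
move=> Xu; rewrite /Eh /Ec; congr (_ * _ + _ * _).
  rewrite -bend_mxE//; apply: J_eq => x _ _.
  by rewrite real_normK ?num_real// mulrA.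
rewrite -[LHS]/(J _) -(interp_gradA (fun y => v y ^+ 2 + Defs.eta P))//.
by apply: J_eq => x xom _; rewrite interp_add_cst.
Qed.

Lemma dEhE u v w : Xh M u -> Xh M w ->
  dEh_u P S xi u v w =
  dEc bend_mx wstiff_mx (mu P) (Defs.eta P) (nodal u) (nodal v) (nodal w).
Proof.
move=> Xu Xw; rewrite /dEh_u /dEc -bend_mxE//; congr (_ + _ * _).
rewrite -[LHS]/(J _) -(interp_gradA (fun y => v y ^+ 2 + Defs.eta P))//.
by apply: J_eq => x xom _; rewrite interp_add_cst.
Qed.

Lemma DhE v : Xh M v ->
  Dh P S xi v = Dc stiff_mx area_vec (kappa P) (eps P) (nodal v).
Proof.
move=> Xv; rewrite /Dh /Dc; congr (_ * _).
have b1 : bmfN (fun x => interp xi (fun y => (1 - v y) ^+ 2) x * sqrt_a S x).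
  by apply: bmM; [exact: interp_bm|exact: sqrt_a_bm].
have b2 := gradA_bm Xv Xv.
rewrite -(interp_sqrt_a (fun y => (1 - v y) ^+ 2)) -stiff_mxE// -!JZ// -JD//.
- by apply: J_eq => x _ _; rewrite mulrA.
- by apply: bmM => //; exact: bm_cst.
- by apply: bmM => //; exact: bm_cst.
Qed.

Lemma Xh_norm_sqr (v z : R * R -> R) : Xh_norm xi (v \- z) ^+ 2 =
  \sum_k (nodal v k - nodal z k) ^+ 2 * mass_vec k.
Proof.
rewrite /Xh_norm sqr_sqrtr; last by rewrite -[leRHS]/(J _); exact: J_ge0.
rewrite -(interp_mass (fun y => (v y - z y) ^+ 2)); apply: J_eq => x /omc xom _.
rewrite ger0_norm// sumr_ge0// => k _.
by rewrite mulr_ge0 ?sqr_ge0 ?(xi_ge0 hxi hA).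
Qed.

Lemma FhE u v z a : Xh M u -> Xh M v ->
  Fh P S xi u v + a / 2 * Xh_norm xi (v \- z) ^+ 2 =
  Jc bend_mx stiff_mx wstiff_mx area_vec mass_vec (mu P) (kappa P) (eps P) (Defs.eta P) a
    (nodal z) (nodal u) (nodal v).
Proof. by move=> Xu Xv; rewrite /Fh EhE// DhE// Xh_norm_sqr. Qed.

(** Criticality is tested in the direction v - psi, whereas [dJc] is taken towards the competitor;
    hence the minus sign. *)
Lemma dFhE u v z psi a : Xh M u -> Xh M v -> Xh M psi ->
  dFh_v P S xi u v (v \- psi)
  + a * \int[leb2 R]_(x in om) interp xi (fun y => (v y - z y) * (v y - psi y)) x =
  - dJc stiff_mx wstiff_mx area_vec mass_vec (mu P) (kappa P) (eps P) a
    (nodal z) (nodal u) (nodal v) (fun k => nodal psi k - nodal v k).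
Proof.
move=> Xu Xv Xpsi.
have Xd : Xh M (v \- psi).
  rewrite (_ : _ \- _ = fun x => 1 * v x + -1 * psi x); first exact: Xh_lin.
  by apply/funext => x; rewrite mul1r mulN1r.
have b1 : bmfN (fun x => interp xi (fun y => (v y - 1) * (v y - psi y)) x * sqrt_a S x).
  by apply: bmM; [exact: interp_bm|exact: sqrt_a_bm].
have b2 := gradA_bm Xv Xd.
rewrite /dFh_v -![X in mu P * X]/(J _) -![X in kappa P * X]/(J _) -![X in a * X]/(J _).
rewrite (interp_gradA (fun y => v y * (v \- psi) y))// interp_mass.
rewrite (J_eq (g := fun x => (2 * eps P)^-1 * (interp xi (fun y => (v y - 1) * (v y - psi y))
  x * sqrt_a S x)
   + 2 * eps P * gradA S v (v \- psi) x)); last by move=> x _ _; rewrite mulrA.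
rewrite JD; last 2 first.
- by apply: bmM => //; exact: bm_cst.
- by apply: bmM => //; exact: bm_cst.
rewrite !JZ// interp_sqrt_a stiff_mxE// /dJc.
have eN (f g : I -> R) : (forall k, f k = - g k) -> \sum_k f k = - \sum_k g k.
  by move=> fg; rewrite -sumrN; apply: eq_bigr => k _.
have -> : \sum_k v (vert k) * (v \- psi) (vert k) * bil (wstiff_mx k) (nodal u) (nodal u) =
    - \sum_k nodal v k * (nodal psi k - nodal v k) * bil (wstiff_mx k) (nodal u) (nodal u).
  by apply: eN => k; rewrite /nodal /=; ring.
have -> : \sum_k (v (vert k) - 1) * (v (vert k) - psi (vert k)) * area_vec k =
    - \sum_k (nodal v k - 1) * (nodal psi k - nodal v k) * area_vec k.
  by apply: eN => k; rewrite /nodal; ring.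
have -> : \sum_k (v (vert k) - z (vert k)) * (v (vert k) - psi (vert k)) * mass_vec k =
    - \sum_k (nodal v k - nodal z k) * (nodal psi k - nodal v k) * mass_vec k.
  by apply: eN => k; rewrite /nodal; ring.
have -> : bil stiff_mx (nodal v) (nodal (v \- psi)) =
    - bil stiff_mx (nodal v) (fun k => nodal psi k - nodal v k).
  rewrite /bil; apply: eN => l; rewrite -sumrN; apply: eq_bigr => m _.
  by rewrite /nodal /=; ring.
ring.
Qed.

Hypothesis om_neq0 : om !=set0.

(** Inverse to [nodal], up to the values of functions outside the closure of [om]; it turns nodal
    vectors into competitors in Xh. *)
Definition fem c : R * R -> R := fun x => \sum_l c l * xi l x.

Lemma fem_Xh c : Xh M (fem c).
Proof.
have [x xom] := om_neq0; have [T TM _] := closure_hull M (omc xom).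
have /card_gt0P[l _] : (0 < #|T|)%N by rewrite (tri_card TM).
exact: (Xh_sum om_open om_bounded _ (xiX l)).
Qed.

Lemma nodal_fem c : nodal (fem c) = c.
Proof.
apply/funext => l; rewrite /nodal /fem (bigD1 l)//= (xi_vert hxi) eqxx mulr1.
by rewrite big1 ?addr0// => m ml; rewrite (xi_vert hxi) (negbTE ml) mulr0.
Qed.

Lemma fem_nodal u x : Xh M u -> closure om x -> fem (nodal u) x = u x.
Proof. by move=> Xu xom; rewrite [RHS](Xh_interp hxi hA Xu). Qed.

Lemma fem_le c u : Xh M u -> (forall k, c k <= nodal u k) ->
  forall x, closure om x -> fem c x <= u x.
Proof.
move=> Xu cu; apply: (Xh_le_vert hxi hA (fem_Xh c) Xu) => l.
by rewrite -[fem c _]/(nodal (fem c) l) nodal_fem; exact: cu.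
Qed.

Lemma bend_mxC l m : bend_mx l m = bend_mx m l.
Proof. by apply: J_eq => x _ _; rewrite mulrAC. Qed.

Lemma wstiff_mxC k l m : wstiff_mx k l m = wstiff_mx k m l.
Proof. by apply: J_eq => x _ _; rewrite gradAC. Qed.

Lemma stiff_mxC l m : stiff_mx l m = stiff_mx m l.
Proof. by apply: J_eq => x _ _; rewrite gradAC. Qed.

Lemma bend_mx_ge0 c : 0 <= bil bend_mx c c.
Proof.
rewrite -(nodal_fem c) -bend_mxE; [|exact: fem_Xh..].
apply: J_ge0 => x /omc xom _.
by rewrite -mulrA mulr_ge0 ?coefb_ge0// -expr2 sqr_ge0.
Qed.

Lemma wstiff_mx_ge0 k c : 0 <= bil (wstiff_mx k) c c.
Proof.
rewrite -(nodal_fem c) -wstiff_mxE; [|exact: fem_Xh..].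
apply: J_ge0 => x /omc xom _.
by rewrite mulr_ge0 ?gradA_ge0 ?(xi_ge0 hxi hA).
Qed.

Lemma stiff_mx_sum c e : bil stiff_mx c e = \sum_k bil (wstiff_mx k) c e.
Proof.
rewrite -(nodal_fem c) -(nodal_fem e) -stiff_mxE; [|exact: fem_Xh..].
have := @interp_gradA (fun=> 1) _ _ (fem_Xh c) (fem_Xh e).
under eq_bigr do rewrite mul1r.
move=> <-; apply: J_eq => x /omc xom _.
rewrite /interp (eq_bigr (fun l => xi l x)) => [|l _]; last by rewrite mul1r.
by rewrite (xi_sum1 hxi hA xom) mul1r.
Qed.

Lemma area_vec_ge0 k : 0 <= area_vec k.
Proof.
apply: J_ge0 => x /omc xom _.
by rewrite mulr_ge0 ?(xi_ge0 hxi hA)// ltW// sqrt_a_gt0.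
Qed.

Lemma mass_vec_gt0 k : 0 < mass_vec k.
Proof.
have [T TM kT] := tri_vert k; apply: (J_gt0 TM (xi_bm k)) => [x /omc xom _|x _ xT].
  exact: (xi_ge0 hxi hA).
by rewrite (hA _ TM) ?xT//; exact: (open_element_hull hxi hA).
Qed.

(** The integrand is nonnegative and would be positive throughout an open element where the constant
    gradient is nonzero. *)
Lemma stiff_mx_flat e : bil stiff_mx e e = 0 -> forall T i, T \in elements M ->
  \sum_m e m * slope (A T m) i = 0.
Proof.
move=> e0 T i TM; apply/eqP; apply: contraT => s0.
have Xe := fem_Xh e.
suff : 0 < J (gradA S (fem e) (fem e)) by rewrite stiff_mxE// nodal_fem e0 ltxx.
apply: (J_gt0 TM (gradA_bm Xe Xe)) => [x /omc xom _|x /omc xom xT]; first exact: gradA_ge0.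
apply: gradA_gt0 => //; apply: contraNneq s0 => /colP/(_ i).
rewrite !mxE (derive_open_element hxi hA i Xe TM xT) => De0.
by apply/eqP; rewrite -[RHS]De0; apply: eq_bigr => m _;
  rewrite -[fem e _]/(nodal (fem e) m) nodal_fem.
Qed.

(** Two continuous representatives of [g] agree almost everywhere in [om], hence everywhere on its
    closure. *)
Lemma eq_on_bdry_unique u u' g : eq_on_bdry om u g -> eq_on_bdry om u' g ->
  forall x, bdry om x -> u x = u' x.
Proof.
move=> [w [cw wg uw]] [w' [cw' wg' uw']] x xb; rewrite uw// uw'//.
apply/eqP; rewrite -subr_eq0; apply/eqP.
apply: (@cc_ae_eq0 _ _ om_open (fun x => w x - w' x)); last by case: xb.
  by apply: ccD; [|apply: ccN]; exact/cc_within.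
have := negligibleU wg wg'; apply: negligibleS => y [yom /= wy].
have [wyg|wyg] := eqVneq (w y) (g y); [right|left] => /= /(_ yom) wyg'.
  by move: wy; rewrite wyg wyg' subrr eqxx.
by rewrite wyg' eqxx in wyg.
Qed.

Lemma eq_on_bdryD u u' g : (forall x, bdry om x -> u x = u' x) ->
  eq_on_bdry om u g -> eq_on_bdry om u' g.
Proof. by move=> uu' [w [cw wg uw]]; exists w; split => // x xb; rewrite -uu'// uw. Qed.

Definition bdry_zero e : Prop := forall x, bdry om x -> fem e x = 0.

Let bdryc x : bdry om x -> closure om x. Proof. by case. Qed.

Lemma bdry_zero_definite e : bdry_zero e -> bil stiff_mx e e = 0 -> forall l, e l = 0.
Proof.
move=> e0 /stiff_mx_flat flat l.
have fe m : fem e (vert m) = e m by rewrite -[LHS]/(nodal (fem e) m) nodal_fem.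
rewrite -fe; apply: (Xh_flat_eq0 hxi hA (fem_Xh e)) => [m mb|T i TM]; first exact: e0.
by rewrite -[RHS](flat T i TM); apply: eq_bigr => m _; rewrite fe.
Qed.

Lemma bdry_zero_closed (s : nat -> I -> R) e : (forall j, bdry_zero (s j)) ->
  (forall l, (fun j => s j l) @ \oo --> e l) -> bdry_zero e.
Proof.
move=> s0 se x xb.
have : (fun j => fem (s j) x) @ \oo --> fem e x.
  by apply: cvg_sumr => l; apply: cvgM => //; exact: cvg_cst.
rewrite (_ : (fun j => _) = cst 0) => [h|]; last by apply/funext => j; exact: s0.
exact: (cvg_unique (@Rhausdorff R) h (cvg_cst 0)).
Qed.

Hypothesis offdiag : forall l m, l != m ->
  \int[leb2 R]_(x in om) gradA S (xi l) (xi m) x <= 0.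

(** * One time step of the scheme *)

Variables (tau : R) (gt u0 v0 : R * R -> R) (U V : nat -> R * R -> R).
Hypotheses (tau_gt0 : 0 < tau) (Xv0 : Xh M v0)
  (v0_01 : forall x, closure om x -> 0 <= v0 x <= 1)
  (hUV : alternating_minimization P S xi tau gt u0 v0 U V).

Let gam := alpha P / tau.
Let gam_gt0 : 0 < gam. Proof. by rewrite divr_gt0// alpha_gt0. Qed.

Let gamE : alpha P / (2 * tau) = gam / 2.
Proof. by rewrite /gam; field; rewrite gt_eqF. Qed.

Let z := nodal v0.
Let c j := nodal (U j).
Let d j := nodal (V j).

Let z_ge0 k : 0 <= z k. Proof. by have /andP[] := v0_01 (@vert_closure _ _ M k). Qed.
Let z_le1 k : z k <= 1. Proof. by have /andP[] := v0_01 (@vert_closure _ _ M k). Qed.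
Let d0 k : d 0%N k = z k. Proof. by rewrite /d; have [_ -> _ _] := hUV. Qed.

Lemma iterate_Xh j : Xh M (U j.+1) /\ Xh M (V j).
Proof.
have [_ V0 hU hV] := hUV; split; first by have [[]] := hU j.
by case: j => [|j]; [rewrite V0|have [[]] := hV j].
Qed.

Let XU j : Xh M (U j.+1) := (iterate_Xh j).1.
Let XV j : Xh M (V j) := (iterate_Xh j).2.

Let d_le j k : d j.+1 k <= z k.
Proof.
by have [_ _ _ hV] := hUV; have [[_ Vle] _] := hV j; apply: Vle; exact: vert_closure.
Qed.

Let Jz := Jc bend_mx stiff_mx wstiff_mx area_vec mass_vec
  (mu P) (kappa P) (eps P) (Defs.eta P) gam z.

Let d_min j e : (forall k, e k <= z k) -> Jz (c j.+1) (d j.+1) <= Jz (c j.+1) e.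
Proof.
move=> ez; have [_ _ _ hV] := hUV; have [_ minV] := hV j.
rewrite /Jz -(nodal_fem e) -!FhE//; last exact: fem_Xh.
by rewrite -gamE; apply: minV; split; [exact: fem_Xh|exact: fem_le].
Qed.

Lemma iterate_nodal_ge0 j k : 0 <= nodal (V j) k.
Proof.
exact: (iterate_ge0 stiff_mxC (mu_gt0 P) (kappa_gt0 P) (eps_gt0 P) gam_gt0
  wstiff_mx_ge0 stiff_mx_sum area_vec_ge0 mass_vec_gt0 offdiag z_ge0 z_le1 d0 d_le d_min).
Qed.

Lemma iterate_nodal_le1 j k : nodal (V j) k <= 1.
Proof. by apply: le_trans (z_le1 k); exact: (iterate_le d0 d_le). Qed.

Let Cl e := eq_on_bdry om (fem e) gt.

Let Cl_U j : Cl (c j.+1).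
Proof.
have [_ _ hU _] := hUV; have [[_ Ug] _] := hU j.
by apply: eq_on_bdryD Ug => x /bdryc xb; rewrite fem_nodal.
Qed.

Let Cl_sub e e' : Cl e -> Cl e' -> bdry_zero (fun l => e l - e' l).
Proof.
move=> ce ce' x xb; have := eq_on_bdry_unique ce ce' xb; rewrite /fem => h.
under eq_bigr do rewrite mulrBl.
by rewrite sumrB h subrr.
Qed.

Let fem_comb e e' t x : fem (comb e t e') x = fem e x + t * fem e' x.
Proof.
by rewrite /fem mulr_sumr -big_split; apply: eq_bigr => l _; rewrite /comb /=; ring.
Qed.

Let Cl_comb e e' t : Cl e -> bdry_zero e' -> Cl (comb e t e').
Proof.
by move=> ce e0; apply: eq_on_bdryD ce => x xb; rewrite fem_comb e0// mulr0 addr0.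
Qed.

Let c_min j e : Cl e -> Ec bend_mx wstiff_mx (mu P) (Defs.eta P) (c j.+1) (d j)
  <= Ec bend_mx wstiff_mx (mu P) (Defs.eta P) e (d j).
Proof.
move=> ce; have [_ _ hU _] := hUV; have [_ minU] := hU j.
have := minU (fem e) (conj (fem_Xh e) ce).
by rewrite (EhE _ (XU j)) (EhE _ (fem_Xh e)) nodal_fem.
Qed.

Let bdry_zero_scale t e : bdry_zero e -> bdry_zero (fun l => t * e l).
Proof.
move=> e0 x xb; rewrite /fem; under eq_bigr do rewrite -mulrA.
by rewrite -mulr_sumr -/(fem e x) e0// mulr0.
Qed.

Lemma cvg_Xh_fem (s : nat -> R * R -> R) e :
  (forall k, (fun j => nodal (s j) k) @ \oo --> e k) -> cvg_Xh xi s (fem e).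
Proof.
move=> se; apply: sqr_cvg0.
rewrite (_ : (fun j => _) = fun j => \sum_k (nodal (s j) k - e k) ^+ 2 * mass_vec k);
  last first.
  by apply/funext => j; rewrite Xh_norm_sqr nodal_fem.
rewrite -[X in _ --> X](_ : \sum_(k < nvert M) (e k - e k) ^+ 2 * mass_vec k = 0); last first.
  by rewrite big1// => k _; rewrite subrr expr0n mul0r.
apply: cvg_sumr => k; apply: cvgM; last exact: cvg_cst.
by rewrite expr2; apply: cvgM; apply: cvgB => //; exact: cvg_cst.
Qed.

(** One term of the diagonal form of the norm, with positive weight [mass_vec k], controls the k-th
    nodal value. *)
Lemma cvg_Xh_nodal (s : nat -> R * R -> R) u k : cvg_Xh xi s u ->
  (fun j => nodal (s j) k) @ \oo --> nodal u k.
Proof.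
move=> su; apply/subr_cvg0; apply: sqr_cvg0.
have n2 : (fun j => (mass_vec k)^-1 * Xh_norm xi (s j \- u) ^+ 2) @ \oo --> (0 : R).
  rewrite -[X in _ --> X](mulr0 (mass_vec k)^-1); apply: cvgM; first exact: cvg_cst.
  by rewrite -[X in _ --> X](expr0n R 2) expr2; apply: cvgM.
apply: (squeeze_cvgr _ (cvg_cst 0) n2); apply: nearW => j.
rewrite sqr_ge0 /= ler_pdivlMl ?mass_vec_gt0// Xh_norm_sqr (bigD1 k)//= mulrC lerDl.
by rewrite sumr_ge0// => l _; rewrite mulr_ge0 ?sqr_ge0// ltW// mass_vec_gt0.
Qed.

(** The state passed on to the next time step may be any subsequential limit, so the bounds are
    shown for all of them. *)
Lemma subseq_limit_01 u v : subseq_limit xi U V u v ->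
  forall x, closure om x -> 0 <= v x <= 1.
Proof.
move=> [_ Xv [s [_ _ cV]]] x xom.
have v01 k : 0 <= nodal v k <= 1.
  have ck := @cvg_Xh_nodal _ _ k cV; apply/andP; split.
    by apply: (cvgr_to_ge ck); apply: nearW => j; exact: iterate_nodal_ge0.
  by apply: (cvgr_to_le ck); apply: nearW => j; exact: iterate_nodal_le1.
rewrite (Xh_interp hxi hA Xv xom); apply/andP; split.
  apply: sumr_ge0 => k _; rewrite mulr_ge0 ?(xi_ge0 hxi hA)//.
  by have /andP[] := v01 k.
rewrite -(xi_sum1 hxi hA xom); apply: ler_sum => k _.
rewrite ler_piMl ?(xi_ge0 hxi hA)//; by have /andP[] := v01 k.
Qed.

Lemma step_critical_point : exists ui vi : R * R -> R,
  subseq_limit xi U V ui vi /\ critical_point P S xi tau v0 ui vi.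
Proof.
have [f hf [cl [dl [cc dc hE hF]]]] := alternating_minimization_cvg bend_mxC wstiff_mxC
  stiff_mxC (mu_gt0 P) (kappa_gt0 P) (eps_gt0 P) (eta_gt0 P) gam_gt0 bend_mx_ge0
  wstiff_mx_ge0 stiff_mx_sum area_vec_ge0 mass_vec_gt0 offdiag bdry_zero_scale
  bdry_zero_closed bdry_zero_definite Cl_sub Cl_comb z_ge0 z_le1 d0 Cl_U c_min d_le d_min.
exists (fem cl), (fem dl); split.
  split; [exact: fem_Xh|exact: fem_Xh|exists f; split => //; exact: cvg_Xh_fem].
have [Xc Xd] := (fem_Xh cl, fem_Xh dl).
split => // [w Xw w0|psi Xpsi psi_le].
- rewrite dEhE// !nodal_fem; apply: hE => x xb.
  by rewrite fem_nodal ?w0//; exact: bdryc.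
- rewrite dFhE// oppr_le0 !nodal_fem; apply: hF => k.
  by apply: psi_le; exact: vert_closure.
Qed.

End discrete_energies.

Unset Implicit Arguments.

Theorem proposition3p4 (R : realType) (P : parameters R)
  (om : set (R * R)) (hom : polygonal_domain om) (S : surface om)
  (M : triangulation om) (xi : 'I_(nvert M) -> R * R -> R)
  (hxi : lagrange_basis xi)
  (hstiff : forall l m, l != m ->
     \int[leb2 R]_(x in om) gradA S (xi l) (xi m) x <= 0)
  (Tf : R) (hTf : 0 < Tf) (k : nat)
  (p : R) (hp : 2 < p)
  (g : R -> R * R -> R) (hg : AC_W1p om p Tf g)
  (hadm : forall i : nat, (1 <= i <= k)%N ->
     exists u, Xh M u /\ eq_on_bdry om u (g (i%:R * (Tf / k%:R))))
  (i : nat) (hi : (1 <= i <= k)%N)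
  (u v : nat -> R * R -> R)
  (hu0 : Xh M (u 0%N)) (hv0 : Xh M (v 0%N))
  (hv01 : forall x, closure om x -> 0 <= v 0%N x <= 1)
  (hsteps : forall l : nat, (1 <= l < i)%N ->
     exists U V : nat -> R * R -> R,
       alternating_minimization P S xi (Tf / k%:R) (g (l%:R * (Tf / k%:R)))
         (u l.-1) (v l.-1) U V
       /\ subseq_limit xi U V (u l) (v l))
  (U V : nat -> R * R -> R)
  (hUV : alternating_minimization P S xi (Tf / k%:R) (g (i%:R * (Tf / k%:R)))
     (u i.-1) (v i.-1) U V) :
  exists ui vi : R * R -> R,
    subseq_limit xi U V ui vi
    /\ critical_point P S xi (Tf / k%:R) (v i.-1) ui vi.
Proof.
have om_open := pd_open hom; have om_bounded := pd_bounded hom.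
(* Membership of the basis in Xh gives affine coefficients element by element; choice collects them,
   with 0 as default for sets that are not elements. *)
have [A hA] : exists A : {set 'I_(nvert M)} -> 'I_(nvert M) -> R * R * R,
    forall T l x, T \in elements M -> hull (vert (t := M)) T x -> xi l x = aff (A T l) x.
  have aff_ex (Tl : {set 'I_(nvert M)} * 'I_(nvert M)) : exists a : R * R * R,
      forall x, Tl.1 \in elements M -> hull (vert (t := M)) Tl.1 x -> xi Tl.2 x = aff a x.
    have [TM|TM] := boolP (Tl.1 \in elements M); last by exists 0.
    have [[_ xi_aff] _] := hxi Tl.2; have [a0 [a1 [a2 xiE]]] := xi_aff _ TM.
    by exists (a0, a1, a2) => x _ /xiE.
  by have [A hA] := choice aff_ex; exists (fun T l => A (T, l)) => T l; exact: hA (T, l).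
have tau_gt0 : 0 < Tf / k%:R.
  by have /andP[i1 ik] := hi; rewrite divr_gt0// ltr0n (leq_trans i1).
have om_neq0 := pd_nonempty hom.
(* The bounds propagate along the earlier steps, each of which starts from a state already known to
   take values in [0, 1]. *)
have states l : (l < i)%N -> Xh M (v l) /\ forall x, closure om x -> 0 <= v l x <= 1.
  elim: l => [|l ih] li; first by split.
  have [Xv v01] := ih (ltnW li); have [U' [V' [hUV' lim]]] := hsteps l.+1 li.
  split; first by have [] := lim.
  exact: (subseq_limit_01 om_open om_bounded hxi hA om_neq0 hstiff tau_gt0 Xv v01 hUV' lim).
have [Xv v01] : Xh M (v i.-1) /\ forall x, closure om x -> 0 <= v i.-1 x <= 1.
  by apply: states; have /andP[i1 _] := hi; rewrite prednK.
exact: (step_critical_point om_open om_bounded hxi hA om_neq0 hstiff tau_gt0 Xv v01 hUV).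
Qed.
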